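(* Let $S$ be an infinite supernatural number and $\lambda$ a non-archimedean length function on $\widetilde{\mathbb Z_S}$ that grows fast enough. Then $C_{RD}(\mathbb Z_S)$, equipped with the norms $\|\cdot\|_N$, $N=0,1,2,\dots$, is a smooth subalgebra of the C$^*$-algebra $C(\mathbb Z_S)$: it is a dense $*$-subalgebra, it is complete (Frechet) for the topology of the norms $\|\cdot\|_N$, which dominate the sup norm, each $\|\cdot\|_N$ is submultiplicative, and for every real-valued $f\in C_{RD}(\mathbb Z_S)$ and every smooth function $F$ on an open neighborhood of the range of $f$ one has $F\circ f\in C_{RD}(\mathbb Z_S)$.
   Context: Odometer: given a scale $(s_m)_{m\ge1}$ (positive integers, $s_m\mid s_{m+1}$, $s_m<s_{m+1}$) with $S=\mathrm{lcm}(s_m)$, $\mathbb Z_S=\varprojlim\mathbb Z/s_m\mathbb Z$, a compact abelian group (Cantor set) with dense cyclic subgroup generated by $1=(1,1,\dots)$; $dx$ is normalized Haar measure. $\widetilde{\mathbb Z_S}=\{z\in\mathbb C:z^s=1\text{ for some } s\mid S\}$; for $z\in\widetilde{\mathbb Z_S}$, $\chi_z$ is the continuous character of $\mathbb Z_S$ with $\chi_z(1)=z$. Fourier coefficients: $\hat f_z=\int_{\mathbb Z_S}f(x)\chi_{\bar z}(x)\,dx$. A non-archimedean length function is $\lambda:\widetilde{\mathbb Z_S}\to[1,\infty)$ with (i) $\lambda(z)=1$ iff $z=1$; (ii) $\lambda(z_1z_2)\le\max\{\lambda(z_1),\lambda(z_2)\}$; (iii) $\{z:\lambda(z)\le r\}$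 finite for all $r\ge1$. It grows fast enough if there are $\alpha,c>0$ with $\lambda(z)\ge c\,(\mathrm{ord}(z))^\alpha$ for all $z$. Norms: $\|f\|_N=\sum_{z\in\widetilde{\mathbb Z_S}}|\hat f_z|\lambda(z)^N$, and $C_{RD}(\mathbb Z_S)=\{f\in C(\mathbb Z_S):\|f\|_N<\infty\ \forall N\ge0\}$. A smooth subalgebra of a unital C$^*$-algebra $A$ is a dense $*$-subalgebra which is Frechet with respect to a countable family of submultiplicative seminorms defining a topology stronger than the norm topology, and which is stable under smooth functional calculus of self-adjoint elements. *)

(* Defs.v *)
From HB Require Import structures.
From mathcomp Require Import all_boot all_order all_algebra.
From mathcomp Require Import all_classical all_reals all_analysis.
From mathcomp Require Import complex.
Set Implicit Arguments. Unset Strict Implicit. Unset Printing Implicit Defensive.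
Import Order.TTheory GRing.Theory Num.Theory.
Import numFieldNormedType.Exports.
Local Open Scope classical_set_scope.
Local Open Scope ring_scope.

(* A scale (s_m)_{m >= 1}; here indexed from m = 0:  s m = s_{m+1}. *)
Record scale := Scale {
  sc :> nat -> nat;
  sc_pos : forall m, (0 < sc m)%N;
  sc_dvd : forall m, (sc m %| sc m.+1)%N;
  sc_lt  : forall m, (sc m < sc m.+1)%N }.

(* Z_S = projective limit of Z / s_m Z : compatible sequences of residues. *)
Definition ZS (s : scale) :=
  {x : nat -> nat | forall m, (x m < s m)%N /\ (x m.+1 %% s m)%N = x m}.

Lemma iotaZS_proof (s : scale) (k : nat) :
  forall m, ((k %% s m) < s m)%N /\ ((k %% s m.+1) %% s m)%N = (k %% s m)%N.
Proof.
move=> m; split; first by rewrite ltn_mod sc_pos.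
by rewrite modn_dvdm // sc_dvd.
Qed.
Definition iotaZS (s : scale) (k : nat) : ZS s :=
  exist _ (fun m => (k %% s m)%N) (iotaZS_proof s k).

Section Defs.
Variable R : realType.
Local Notation C := R[i].
Local Notation normc := (@ComplexField.Normc.normc R).

(* Continuity of f : Z_S -> C for the projective-limit (Cantor) topology,
   whose neighbourhood basis at x is given by the cylinders {y | y_m = x_m}. *)
Definition contZS (s : scale) (f : ZS s -> C) : Prop :=
  forall (x : ZS s) (e : R), 0 < e -> exists m : nat,
    forall y : ZS s, sval y m = sval x m -> normc (f y - f x) < e.

(* Normalized Haar integral of a continuous function on Z_S, as the limit of
   Riemann sums over the cylinder partitions {x | x_m = a}, a < s_m
   (representatives a = iotaZS a, each cylinder having Haar measure 1/s_m). *)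
Definition riemannZS (s : scale) (f : ZS s -> C) (n : nat) : C :=
  (s n)%:R^-1 * \sum_(k < s n) f (iotaZS s k).
Definition haarZS (s : scale) (f : ZS s -> C) : C :=
  Complex (limn (fun n => @complex.Re R (riemannZS f n)))
          (limn (fun n => @complex.Im R (riemannZS f n))).

Definition dualZS (s : scale) : set C := [set z | exists m, z ^+ s m = 1].

(* chi_z(x) = z^(x_m) for any m with z^(s_m) = 1 (independent of the choice). *)
Definition chiZS (s : scale) (z : C) (x : ZS s) : C :=
  z ^+ (sval x (xget 0%N [set m | z ^+ s m = 1])).

Definition fhat (s : scale) (f : ZS s -> C) (z : C) : C :=
  haarZS (fun x => f x * chiZS (conjc z) x).

Definition is_order (z : C) (n : nat) : Prop :=
  (0 < n)%N /\ z ^+ n = 1 /\ forall k, (0 < k < n)%N -> z ^+ k <> 1.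

(* Non-archimedean length function on ~Z_S (values of lam outside ~Z_S are
   irrelevant). *)
Definition length_fn (s : scale) (lam : C -> R) : Prop :=
  (forall z, dualZS s z -> 1 <= lam z) /\
  (forall z, dualZS s z -> (lam z = 1 <-> z = 1)) /\
  (forall z1 z2, dualZS s z1 -> dualZS s z2 ->
     lam (z1 * z2) <= Num.max (lam z1) (lam z2)) /\
  (forall r : R, 1 <= r -> finite_set [set z | dualZS s z /\ lam z <= r]).

Definition grows_fast (s : scale) (lam : C -> R) : Prop :=
  exists alpha c : R, 0 < alpha /\ 0 < c /\
    forall z n, dualZS s z -> is_order z n -> c * (n%:R `^ alpha) <= lam z.

Definition normN (s : scale) (lam : C -> R) (N : nat) (f : ZS s -> C) : \bar R :=
  (\esum_(z in dualZS s) ((normc (fhat f z) * lam z ^+ N)%:E))%E.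

Definition CRD (s : scale) (lam : C -> R) (f : ZS s -> C) : Prop :=
  contZS f /\ forall N, (normN lam N f < +oo)%E.

Definition smooth_on (U : set R) (g : R -> R) : Prop :=
  forall (n : nat) (x : R), U x -> derivable (derive1n n g) x 1.

End Defs.

(* Main.v *)
(** By the ultrametric inequality, [V = {w | lam w < lam z}] is a finite
    subgroup of the dual for each [z].  If [n] is the order of [V], then
    translating [f] by multiples of [n] only affects the coefficients outside
    [V], so it moves [f] by at most [2 ||f||_N / lam z ^ N] in sup norm;
    conversely the [z]-coefficient of any continuous [g] is bounded by the sup
    distance from [g] to its translates by multiples of [n].  Hence any [g] that
    oscillates at most [L] times as much as [f], such as [F \o f] with [F] of
    class C^1, has coefficients [O(lam z ^ -N)] for every [N], and fast growth
    makes [\sum_z lam z ^ -M] finite for some [M].  Sup-norm domination and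
    submultiplicativity come from the Fourier sums over the [s m]-th roots of
    unity, which converge uniformly because their kernel is a normalized
    indicator of a cylinder, and from Fatou's lemma. *)

Require Import Defs.
From HB Require Import structures.
From mathcomp Require Import all_boot all_order all_algebra.
From mathcomp Require Import cyclic separable cyclotomic.
From mathcomp Require Import all_classical all_reals all_analysis.
From mathcomp Require Import complex.
From mathcomp Require Import ring lra.
Set Implicit Arguments. Unset Strict Implicit. Unset Printing Implicit Defensive.
Import Order.TTheory GRing.Theory Num.Theory.
Import numFieldNormedType.Exports.
Local Open Scope classical_set_scope.
Local Open Scope ring_scope.

(** * The real-valued modulus on the complex numbers, and roots of unity *)

Section ComplexModulus.
Variable R : realType.
Local Notation C := R[i].
Local Notation normc := (@ComplexField.Normc.normc R).
Implicit Types z w : C.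

Lemma normcR z : `|z| = (normc z)%:C%C.
Proof. by case: z. Qed.

Lemma normc_ge0 z : 0 <= normc z.
Proof. by case: z => a b; exact: sqrtr_ge0. Qed.

Lemma normc_triangle z w : normc (z + w) <= normc z + normc w.
Proof. exact: le_normcD. Qed.

Lemma normc_opp z : normc (- z) = normc z.
Proof. exact: normcN. Qed.

Lemma normcB z w : normc (z - w) = normc (w - z).
Proof. by rewrite -normc_opp opprB. Qed.

Lemma normc_dist3 z w v : normc (z - v) <= normc (z - w) + normc (w - v).
Proof. by rewrite -(subrKA w z) normc_triangle. Qed.

Lemma normcX z n : normc (z ^+ n) = normc z ^+ n.
Proof.
elim: n => [|n IH]; first by rewrite !expr0; exact: ComplexField.Normc.normc1.
by rewrite !exprS ComplexField.Normc.normcM IH.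
Qed.

Lemma normc_conj z : normc (conjc z) = normc z.
Proof. by case: z => a b /=; rewrite sqrrN. Qed.

Lemma normc_real (a : R) : normc (a%:C%C) = `|a|.
Proof. by rewrite /= expr0n addr0 sqrtr_sqr. Qed.

Lemma normc_nat n : normc n%:R = n%:R.
Proof. by rewrite -(rmorph_nat (real_complex R)) normc_real ger0_norm. Qed.

Lemma normc_sum (I : Type) (r : seq I) (P : pred I) (F : I -> C) :
  normc (\sum_(i <- r | P i) F i) <= \sum_(i <- r | P i) normc (F i).
Proof.
elim/big_rec2: _ => [|i y x _ h]; first by rewrite ComplexField.Normc.normc0.
by rewrite (le_trans (normc_triangle _ _))// lerD2l.
Qed.

Lemma normc_geRe z : `|complex.Re z| <= normc z.
Proof. by have := normc_ge_Re z; rewrite normcR lecR. Qed.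

Lemma normc_geIm z : `|complex.Im z| <= normc z.
Proof.
by case: z => a b /=; rewrite -sqrtr_sqr ler_wsqrtr// lerDr sqr_ge0.
Qed.

Lemma normc_leReIm z : normc z <= `|complex.Re z| + `|complex.Im z|.
Proof.
rewrite [z in normc z]complexE; apply: le_trans (normc_triangle _ _) _.
rewrite ComplexField.Normc.normcM !normc_real /=.
by rewrite expr0n expr1n add0r sqrtr1 mul1r.
Qed.

Lemma normc_unity z n : (0 < n)%N -> z ^+ n = 1 -> normc z = 1.
Proof.
move=> n0 /(congr1 normc); rewrite normcX ComplexField.Normc.normc1 => /eqP.
by rewrite -[X in _ == X](expr1n R n) eqrXn2// ?normc_ge0// => /eqP.
Qed.

Lemma conjc_unity z n : (0 < n)%N -> z ^+ n = 1 -> conjc z = z^-1.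
Proof.
move=> n0 zn; have z0 : z != 0.
  by apply/eqP => z0; move: zn; rewrite z0 expr0n eqn0Ngt n0 => /eqP; rewrite eq_sym oner_eq0.
apply: (mulfI z0); rewrite divff// -sqr_normc normcR (normc_unity n0 zn).
by rewrite expr1n.
Qed.

(** The polynomial X^n - 1 splits and, [n] being nonzero in the field, is separable; so it has [n]
    distinct roots, and a group of [n] roots of unity contains a primitive one. *)
Lemma primitive_rootC n : (0 < n)%N -> exists z : C, n.-primitive_root z.
Proof.
move=> n_gt0; have [r rE] := closed_field_poly_normal ('X^n - 1 : {poly C}).
have lc1 : lead_coef ('X^n - 1 : {poly C}) = 1.
  by apply/monicP; rewrite monicXnsubC.
rewrite lc1 scale1r in rE.
have nC : n%:R != 0 :> C by rewrite pnatr_eq0 -lt0n.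
have ur : uniq r
  by rewrite -separable_prod_XsubC -rE separable_Xn_sub_1.
have sz_r : size r = n.
  by have := size_prod_XsubC r id; rewrite -rE size_XnsubC// => -[].
suff /hasP[z _ zP] : has n.-primitive_root r by exists z.
apply: has_prim_root; rewrite ?sz_r//.
by apply/allP => z; rewrite -root_prod_XsubC -rE.
Qed.
End ComplexModulus.

(** * Compactness of the odometer, and translation on it *)

Section Odometer.
Variable s : scale.
Implicit Types (x y : ZS s) (m n k t : nat).

Lemma scale_dvdn m n : (m <= n)%N -> (s m %| s n)%N.
Proof.
move=> /subnK <-; elim: (n - m)%N => [//|i IH].
by rewrite addSn (dvdn_trans IH)// sc_dvd.
Qed.

Lemma scale_gt n : (n < s n)%N.
Proof.
elim: n => [|n IH]; first exact: sc_pos.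
exact: leq_ltn_trans IH (sc_lt s n).
Qed.

Lemma ZS_ltn x m : (sval x m < s m)%N.
Proof. by case: (svalP x m). Qed.

Lemma ZS_modn x m n : (m <= n)%N -> (sval x n %% s m)%N = sval x m.
Proof.
move=> /subnK <-; elim: (n - m)%N => [|i IH]; first by rewrite modn_small ?ZS_ltn.
rewrite -[RHS]IH -[in RHS](svalP x (i + m)%N).2 addSn.
by rewrite modn_dvdm// scale_dvdn// leq_addl.
Qed.

Lemma ZS_eq_le x y m n : (m <= n)%N -> sval y n = sval x n -> sval y m = sval x m.
Proof. by move=> mn xy; rewrite -(ZS_modn x mn) -(ZS_modn y mn) xy. Qed.

Lemma iotaZS_small m k : (k < s m)%N -> sval (iotaZS s k) m = k.
Proof. by move=> km /=; rewrite modn_small. Qed.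

(** The maximum of finitely many bounds serves all of them; in the compactness proof it merges the
    bounds of the finitely many subcylinders of a cylinder. *)
Lemma bounded_choice (N : nat) (Q : nat -> nat -> Prop) :
  (forall a b M, (b <= M)%N -> Q a b -> Q a M) ->
  (forall a, (a < N)%N -> exists b, Q a b) ->
  exists M, forall a, (a < N)%N -> Q a M.
Proof.
move=> Qmono; elim: N => [|N IH] QN; first by exists 0%N.
have [M MP] := IH (fun a aN => QN a (ltnW aN)).
have [b bP] := QN N (ltnSn N).
exists (maxn M b) => a; rewrite ltnS leq_eqVlt => /orP[/eqP->|/MP h].
  exact: Qmono (leq_maxr _ _) bP.
exact: Qmono (leq_maxl _ _) h.
Qed.

(* Compactness of Z_S, by Konig's lemma: otherwise some nested sequence of
   cylinders has no uniform bound, and its intersection point contradicts the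
   local bound. *)
Lemma ZS_uniform_bound (P : nat -> ZS s -> Prop) :
  (forall m n x, (m <= n)%N -> P m x -> P n x) ->
  (forall x, exists m, forall y, sval y m = sval x m -> P m y) ->
  exists M, forall x, P M x.
Proof.
move=> Pmono Ploc.
pose good m a := exists M, forall y, sval y m = a -> P M y.
have Gmono m a b M : (b <= M)%N -> (forall y, sval y m = a -> P b y) ->
    (forall y, sval y m = a -> P M y).
  by move=> bM h y /h; exact: Pmono.
have goodS m a : (forall b, (b < s m.+1)%N -> (b %% s m)%N = a -> good m.+1 b) ->
    good m a.
  move=> h; have [|b bs|M MP] := @bounded_choice (s m.+1)
      (fun b M => forall y, (b %% s m)%N = a -> sval y m.+1 = b -> P M y).
  - by move=> b c M cM h1 y h2 h3; apply: (Pmono c) => //; exact: h1 h2 h3.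
  (* Residues [b] that do not lie over [a] satisfy the predicate vacuously, with the dummy bound
     0. *)
  - have [/(h b bs)[M MP]|ba] := pselect ((b %% s m)%N = a); last by exists 0%N.
    by exists M => y _; exact: MP.
  - exists M => y ya; apply: (MP (sval y m.+1)) => //; first exact: ZS_ltn.
    by rewrite ZS_modn.
apply: contrapT => /forallNP nM.
have [a0 a0s bad0] : exists2 a, (a < s 0)%N & ~ good 0%N a.
  apply: contrapT => /forall2NP h.
  have [|b bs|M MP] := @bounded_choice (s 0%N)
      (fun b M => forall y, sval y 0%N = b -> P M y).
  - by move=> b c M; exact: Gmono.
  - by have [//|/contrapT] := h b.
  - by apply: (nM M) => y; apply: (MP (sval y 0%N)) => //; exact: ZS_ltn.
(* Bad cylinders as pairs of level and residue; with badness packed into the type, dependent choice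
   yields an infinite branch, whose residues form a point of the odometer. *)
pose T := {p : nat * nat | (p.2 < s p.1)%N /\ ~ good p.1 p.2}.
have step (p : T) : {q : T | (sval q).1 = (sval p).1.+1 /\
    ((sval q).2 %% s (sval p).1)%N = (sval p).2}.
  apply: cid; case: p => -[m a] [/= am bad].
  have [b [bs ba bbad]] : exists b, [/\ (b < s m.+1)%N, (b %% s m)%N = a & ~ good m.+1 b].
    apply: contrapT => /forallNP h; apply: bad; apply: goodS => b bs ba.
    by apply: contrapT => nb; apply: (h b); split.
  by exists (exist _ (m.+1, b) (conj bs bbad)).
have [u [u0 uS]] := dependent_choice step (exist _ (0%N, a0) (conj a0s bad0)).
have u1 m : (sval (u m)).1 = m.
  by elim: m => [|m IH]; [rewrite u0|rewrite (uS m).1 IH].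
have xP m : ((sval (u m)).2 < s m)%N /\ ((sval (u m.+1)).2 %% s m)%N = (sval (u m)).2.
  split; first by have := (svalP (u m)).1; rewrite u1.
  by have := (uS m).2; rewrite u1.
pose x : ZS s := exist _ (fun m => (sval (u m)).2) xP.
have [m mP] := Ploc x; have := (svalP (u m)).2; rewrite u1; apply.
by exists m.
Qed.

Lemma shiftZS_proof t x m :
  ((sval x m + t) %% s m < s m)%N /\
  (((sval x m.+1 + t) %% s m.+1) %% s m)%N = ((sval x m + t) %% s m)%N.
Proof.
split; first by rewrite ltn_mod sc_pos.
by rewrite modn_dvdm ?sc_dvd// -modnDml ZS_modn.
Qed.
(** Translation by [t] times the generator 1 of the dense cyclic subgroup. *)
Definition shiftZS t x : ZS s :=
  exist _ (fun m => ((sval x m + t) %% s m)%N) (shiftZS_proof t x).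

Lemma ZS_ext x y : (forall m, sval x m = sval y m) -> x = y.
Proof.
case: x y => [x xP] [y yP] /= /funext xy.
by move: xP yP; rewrite xy => xP yP; congr exist; exact: Prop_irrelevance.
Qed.

Lemma shift_iotaZS t k : shiftZS t (iotaZS s k) = iotaZS s (k + t).
Proof. by apply: ZS_ext => m /=; rewrite modnDml. Qed.

Lemma shiftZS0 x : shiftZS 0 x = x.
Proof. by apply: ZS_ext => m /=; rewrite addn0 modn_small ?ZS_ltn. Qed.

Lemma shiftZSD t n x : shiftZS t (shiftZS n x) = shiftZS (n + t) x.
Proof. by apply: ZS_ext => m /=; rewrite modnDml addnA. Qed.

End Odometer.

(** * Limits and means of complex sequences *)

Section ComplexLimits.
Variable R : realType.
Local Notation C := R[i].
Local Notation normc := (@ComplexField.Normc.normc R).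
Implicit Types (u v : nat -> C) (l : C).

(** Convergence in modulus; [cvgC_lim] links it to the separate limits of real and imaginary parts
    by which [haarZS] is defined. *)
Definition cvgC u l := forall e : R, 0 < e ->
  exists n0, forall n, (n0 <= n)%N -> normc (u n - l) < e.

Lemma cvgC_Re u l : cvgC u l -> complex.Re (u n) @[n --> \oo] --> complex.Re l.
Proof.
move=> ul; apply/cvgrPdist_lt => e /ul[n0 h]; exists n0 => // n /= n0n.
by rewrite -raddfB (le_lt_trans (normc_geRe _))// normcB h.
Qed.

Lemma cvgC_Im u l : cvgC u l -> complex.Im (u n) @[n --> \oo] --> complex.Im l.
Proof.
move=> ul; apply/cvgrPdist_lt => e /ul[n0 h]; exists n0 => // n /= n0n.
by rewrite -raddfB (le_lt_trans (normc_geIm _))// normcB h.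
Qed.

Lemma cvgC_lim u l : cvgC u l ->
  Complex (limn (fun n => complex.Re (u n))) (limn (fun n => complex.Im (u n))) = l.
Proof.
move=> ul; have /(cvg_lim (@Rhausdorff R)) -> := cvgC_Re ul.
have /(cvg_lim (@Rhausdorff R)) -> := cvgC_Im ul.
by case: l {ul}.
Qed.

Lemma cvgC_cauchy u :
  (forall e : R, 0 < e -> exists n0, forall n, (n0 <= n)%N -> normc (u n - u n0) < e) ->
  exists l, cvgC u l.
Proof.
move=> uc.
have hR : cvgn (fun n => complex.Re (u n)).
  apply/cauchy_cvgP/cauchy_exP => e /uc[n0 h]; exists (complex.Re (u n0)).
  exists n0 => // n /= n0n; rewrite /ball/= -raddfB.
  by rewrite (le_lt_trans (normc_geRe _))// normcB h.
have hI : cvgn (fun n => complex.Im (u n)).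
  apply/cauchy_cvgP/cauchy_exP => e /uc[n0 h]; exists (complex.Im (u n0)).
  exists n0 => // n /= n0n; rewrite /ball/= -raddfB.
  by rewrite (le_lt_trans (normc_geIm _))// normcB h.
exists (Complex (limn (fun n => complex.Re (u n))) (limn (fun n => complex.Im (u n)))).
move=> e e0; have e2 : 0 < e / 2 by rewrite divr_gt0.
move/cvgrPdist_lt : hR => /(_ _ e2)[n1 _ h1].
move/cvgrPdist_lt : hI => /(_ _ e2)[n2 _ h2].
exists (maxn n1 n2) => n; rewrite geq_max => /andP[/h1 + /h2].
rewrite /= => {}h1 {}h2; apply: le_lt_trans (normc_leReIm _) _.
rewrite [e]splitr; apply: ltrD; rewrite raddfB distrC//=.
Qed.

Lemma cvgC_cst l : cvgC (fun=> l) l.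
Proof.
by move=> e e0; exists 0%N => n _; rewrite subrr ComplexField.Normc.normc0.
Qed.

Lemma cvgCD u v l l' : cvgC u l -> cvgC v l' -> cvgC (fun n => u n + v n) (l + l').
Proof.
move=> ul vl e e0; have e2 : 0 < e / 2 by rewrite divr_gt0.
have [n1 h1] := ul _ e2; have [n2 h2] := vl _ e2.
exists (maxn n1 n2) => n; rewrite geq_max => /andP[/h1 + /h2] => {}h1 {}h2.
rewrite opprD addrACA [e]splitr (le_lt_trans (normc_triangle _ _))//.
exact: ltrD.
Qed.

Lemma cvgCZ a u l : cvgC u l -> cvgC (fun n => a * u n) (a * l).
Proof.
move=> ul e e0; have a1 : 0 < normc a + 1 by rewrite ltr_wpDl// normc_ge0.
have [n0 h] := ul _ (divr_gt0 e0 a1); exists n0 => n /h.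
rewrite ltr_pdivlMr// -mulrBr ComplexField.Normc.normcM; apply: le_lt_trans.
by rewrite mulrC ler_wpM2l ?normc_ge0// lerDl.
Qed.

Lemma cvgC_conj u l : cvgC u l -> cvgC (fun n => conjc (u n)) (conjc l).
Proof.
move=> ul e /ul[n0 h]; exists n0 => n /h.
by rewrite -[X in X < _]normc_conj rmorphB.
Qed.

Lemma cvgC_norm_le u l B : cvgC u l -> (exists n0, forall n, (n0 <= n)%N -> normc (u n) <= B) ->
  normc l <= B.
Proof.
move=> ul [n0 uB]; apply/ler_addgt0Pr => e /ul[n1 h].
have := h (maxn n0 n1) (leq_maxr _ _); have := uB (maxn n0 n1) (leq_maxl _ _).
set w := u _ => wB /ltW wl; rewrite -(subrK w l).
by rewrite (le_trans (normc_triangle _ _))// addrC lerD// normcB.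
Qed.

Lemma cvgC_squeeze u v l : cvgC u l ->
  (forall e : R, 0 < e -> exists n0, forall n, (n0 <= n)%N -> normc (v n - u n) <= e) ->
  cvgC v l.
Proof.
move=> ul vu e e0; have e2 : 0 < e / 2 by rewrite divr_gt0.
have [n1 h1] := ul _ e2; have [n2 h2] := vu _ e2.
exists (maxn n1 n2) => n; rewrite geq_max => /andP[/h1 + /h2] => {}h1 {}h2.
by rewrite [e]splitr (le_lt_trans (normc_dist3 _ (u n) _))// ler_ltD.
Qed.

Lemma normc_mean_le n (F : nat -> C) B : (0 < n)%N ->
  (forall k, (k < n)%N -> normc (F k) <= B) ->
  normc (n%:R^-1 * \sum_(k < n) F k) <= B.
Proof.
move=> n0 FB; rewrite ComplexField.Normc.normcM ComplexField.Normc.normcV normc_nat.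
rewrite mulrC ler_pdivrMr ?ltr0n//; apply: le_trans (normc_sum _ _ _) _.
have -> : B * n%:R = \sum_(k < n) B by rewrite sumr_const card_ord mulr_natr.
by apply: ler_sum => k _; exact: FB.
Qed.

(** Every residue modulo [p] occurs exactly [q] times among the first [q * p] integers. *)
Lemma sum_modn p q (h : nat -> C) :
  \sum_(k < q * p) h (k %% p)%N = q%:R * \sum_(k < p) h k.
Proof.
elim: q => [|q IH]; first by rewrite big_ord0 mul0r.
rewrite mulSn big_split_ord/= -natr1 mulrDl mul1r addrC.
congr (_ + _); last by apply: eq_bigr => i _; rewrite modn_small.
by rewrite -IH; apply: eq_bigr => i _; rewrite modnDl.
Qed.

End ComplexLimits.

(** * Continuous functions and characters on the odometer *)

Section Continuity.
Variables (R : realType) (s : scale).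
Local Notation C := R[i].
Local Notation normc := (@ComplexField.Normc.normc R).
Implicit Types (f g : ZS s -> C) (x y : ZS s) (e B : R).

(** Uniform continuity by compactness: a level that serves [x] with tolerance [e / 2] serves every
    point of its cylinder with tolerance [e], by comparison through [f x]. *)
Lemma contZS_unif f : contZS f -> forall e, 0 < e ->
  exists m, forall x y, sval y m = sval x m -> normc (f y - f x) < e.
Proof.
move=> cf e e0.
have [||m mP] := @ZS_uniform_bound s
    (fun m x => forall y, sval y m = sval x m -> normc (f y - f x) < e).
- by move=> m n x mn h y yx; apply: h; exact: ZS_eq_le mn yx.
- move=> x; have [m mP] := cf x _ (divr_gt0 e0 (ltr0n R 2)).
  exists m => y yx z zy; rewrite [e]splitr.
  apply: le_lt_trans (normc_dist3 _ (f x) _) _; apply: ltrD.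
    by apply: mP; rewrite zy.
  by rewrite normcB mP.
by exists m => x y; exact: mP.
Qed.

(** At a level where [f] varies by less than 1 on each cylinder, its finitely many values at the
    representatives control all of it. *)
Lemma contZS_bounded f : contZS f -> exists2 B, 0 <= B & forall x, normc (f x) <= B.
Proof.
move=> /contZS_unif/(_ _ ltr01)[m mP].
exists (\sum_(k < s m) normc (f (iotaZS s k)) + 1).
  by rewrite addr_ge0// sumr_ge0// => k _; exact: normc_ge0.
move=> x; rewrite -(subrK (f (iotaZS s (sval x m))) (f x)).
rewrite addrC (le_trans (normc_triangle _ _))// lerD//.
  rewrite (bigD1 (Ordinal (ZS_ltn x m)))//= lerDl.
  by rewrite sumr_ge0// => k _; exact: normc_ge0.
by apply/ltW/mP; rewrite iotaZS_small// ZS_ltn.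
Qed.

Lemma contZS_cst (c : C) : contZS (fun _ : ZS s => c).
Proof.
by move=> x e e0; exists 0%N => y _; rewrite subrr ComplexField.Normc.normc0.
Qed.

Lemma contZSD f g : contZS f -> contZS g -> contZS (fun x => f x + g x).
Proof.
move=> cf cg x e e0; have e2 : 0 < e / 2 by rewrite divr_gt0.
have [m mP] := cf x _ e2; have [n nP] := cg x _ e2.
exists (maxn m n) => y yx; rewrite opprD addrACA [e]splitr.
apply: le_lt_trans (normc_triangle _ _) _.
by rewrite ltrD ?mP ?nP//; apply: ZS_eq_le yx; rewrite ?leq_maxl ?leq_maxr.
Qed.

Lemma contZSM f g : contZS f -> contZS g -> contZS (fun x => f x * g x).
Proof.
move=> cf cg x e e0; have e2 : 0 < e / 2 by rewrite divr_gt0.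
have [B B0 fB] := contZS_bounded cf; have [D D0 gD] := contZS_bounded cg.
have B1 : 0 < B + 1 by rewrite ltr_wpDl.
have D1 : 0 < D + 1 by rewrite ltr_wpDl.
have [m mP] := cf x _ (divr_gt0 e2 D1); have [n nP] := cg x _ (divr_gt0 e2 B1).
exists (maxn m n) => y yx.
have -> : f y * g y - f x * g x = (f y - f x) * g y + f x * (g y - g x) by ring.
rewrite [e]splitr (le_lt_trans (normc_triangle _ _))//.
rewrite !ComplexField.Normc.normcM ltrD//.
  have := mP y (ZS_eq_le (leq_maxl _ _) yx); rewrite ltr_pdivlMr//; apply: le_lt_trans.
  by rewrite ler_wpM2l ?normc_ge0// (le_trans (gD y))// lerDl.
have := nP y (ZS_eq_le (leq_maxr _ _) yx); rewrite ltr_pdivlMr// mulrC; apply: le_lt_trans.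
by rewrite ler_wpM2r ?normc_ge0// (le_trans (fB x))// lerDl.
Qed.

Lemma contZSZ (c : C) f : contZS f -> contZS (fun x => c * f x).
Proof. by apply: contZSM; exact: contZS_cst. Qed.

Lemma contZSB f g : contZS f -> contZS g -> contZS (fun x => f x - g x).
Proof.
move=> cf /(contZSZ (-1)) cg; have := contZSD cf cg.
by under [X in contZS X -> _]eq_fun do rewrite mulN1r.
Qed.

Lemma contZS_conj f : contZS f -> contZS (fun x => conjc (f x)).
Proof.
move=> cf x e /(cf x)[m mP]; exists m => y /mP.
by rewrite -[X in X < _]normc_conj rmorphB.
Qed.

Lemma contZS_sum (I : Type) (r : seq I) (F : I -> ZS s -> C) :
  (forall i, contZS (F i)) -> contZS (fun x => \sum_(i <- r) F i x).
Proof.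
move=> cF; elim: r => [|i r IH].
  by under eq_fun do rewrite big_nil; exact: contZS_cst.
by under eq_fun do rewrite big_cons; exact: contZSD.
Qed.

Lemma contZS_shift t f : contZS f -> contZS (fun x => f (shiftZS t x)).
Proof.
by move=> cf x e /(cf (shiftZS t x))[m mP]; exists m => y yx; apply: mP => /=; rewrite yx.
Qed.

Lemma contZS_uniform_limit f :
  (forall e, 0 < e -> exists g, contZS g /\ forall x, normc (f x - g x) <= e) ->
  contZS f.
Proof.
move=> fg x e e0; have e3 : 0 < e / 3 by rewrite divr_gt0.
have [g [cg gP]] := fg _ e3; have [m mP] := cg x _ e3.
exists m => y /mP h.
have := normc_dist3 (f y) (g y) (f x); have := normc_dist3 (g y) (g x) (f x).
by have := gP x; rewrite normcB; have := gP y; lra.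
Qed.

(** Frees [chiZS] from the level picked by [xget]: two admissible levels give exponents congruent
    modulo the smaller scale entry, which already kills [z]. *)
Lemma chiZS_eq (z : C) m x : z ^+ s m = 1 -> chiZS z x = z ^+ sval x m.
Proof.
move=> zm; rewrite /chiZS; set k := xget _ _.
have zk : z ^+ s k = 1 by rewrite /k; apply: (xgetI 0%N (P := [set m | z ^+ s m = 1]) zm).
have [km|/ltnW mk] := leqP k m.
  by rewrite -(ZS_modn x km) expr_mod.
by rewrite -(ZS_modn x mk) expr_mod.
Qed.

Lemma unity_scale_le (z : C) m n : (m <= n)%N -> z ^+ s m = 1 -> z ^+ s n = 1.
Proof.
by move=> mn zm; rewrite -(divnK (scale_dvdn s mn)) mulnC exprM zm expr1n.
Qed.

Lemma dualZS_conj (z : C) : dualZS s z -> dualZS s (conjc z).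
Proof. by move=> [m zm]; exists m; rewrite -rmorphXn zm rmorph1. Qed.

Lemma dualZSM (z w : C) : dualZS s z -> dualZS s w -> dualZS s (z * w).
Proof.
move=> [m zm] [n wn]; exists (maxn m n).
by rewrite exprMn (unity_scale_le (leq_maxl _ _) zm) (unity_scale_le (leq_maxr _ _) wn) mulr1.
Qed.

Lemma dualZS1 : dualZS s (1 : C).
Proof. by exists 0%N; rewrite expr1n. Qed.

Lemma dualZSX (z : C) n : dualZS s z -> dualZS s (z ^+ n).
Proof.
move=> dz; elim: n => [|n IH]; first exact: dualZS1.
by rewrite exprS; exact: dualZSM.
Qed.

Lemma dualZS_normc (z : C) : dualZS s z -> normc z = 1.
Proof. by move=> [m zm]; exact: normc_unity (sc_pos s m) zm. Qed.

Lemma dualZS_conjV (z : C) : dualZS s z -> conjc z = z^-1.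
Proof. by move=> [m zm]; exact: conjc_unity (sc_pos s m) zm. Qed.

Lemma dualZS_neq0 (z : C) : dualZS s z -> z != 0.
Proof.
move=> /dualZS_normc z1; apply/eqP => z0; move: z1.
by rewrite z0 ComplexField.Normc.normc0 => /eqP; rewrite eq_sym oner_eq0.
Qed.

Lemma chiZSM (z w : C) x : dualZS s z -> dualZS s w ->
  chiZS z x * chiZS w x = chiZS (z * w) x.
Proof.
move=> [m zm] [n wn].
have zN := unity_scale_le (leq_maxl m n) zm; have wN := unity_scale_le (leq_maxr m n) wn.
by rewrite (chiZS_eq x zN) (chiZS_eq x wN) (@chiZS_eq (z * w) (maxn m n)) exprMn ?zN ?wN ?mul1r.
Qed.

Lemma chiZS1 x : chiZS (1 : C) x = 1.
Proof. by rewrite (@chiZS_eq 1 0%N) expr1n. Qed.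

Lemma chiZS_shift (z : C) t x : dualZS s z -> chiZS z (shiftZS t x) = z ^+ t * chiZS z x.
Proof.
by move=> [m zm]; rewrite !(chiZS_eq _ zm)/= expr_mod// exprD mulrC.
Qed.

Lemma contZS_chi (z : C) : dualZS s z -> contZS (@chiZS R s z).
Proof.
move=> [m zm] x e e0; exists m => y yx.
by rewrite !(chiZS_eq _ zm) yx subrr ComplexField.Normc.normc0.
Qed.

Lemma normc_chi (z : C) x : dualZS s z -> normc (chiZS z x) = 1.
Proof.
by move=> dz; case: (dz) => m zm; rewrite (chiZS_eq _ zm) normcX (dualZS_normc dz) expr1n.
Qed.

End Continuity.

(** * The Haar integral, its translation invariance, and Fourier coefficients *)

Section Haar.
Variables (R : realType) (s : scale).
Local Notation C := R[i].
Local Notation normc := (@ComplexField.Normc.normc R).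
Implicit Types (f g : ZS s -> C) (x y : ZS s) (e B : R).

Lemma haarZS_eq f l : cvgC (riemannZS f) l -> haarZS f = l.
Proof. exact: cvgC_lim. Qed.

(** Repeating each coarse representative [s n / s m] times puts both Riemann sums on the same index
    set, so that they can be compared term by term. *)
Lemma riemannZS_coarse f m n : (m <= n)%N ->
  riemannZS f m = (s n)%:R^-1 * \sum_(k < s n) f (iotaZS s (k %% s m)%N).
Proof.
move=> mn; have /dvdnP[q qE] := scale_dvdn s mn.
have sm0 : (s m)%:R != 0 :> C by rewrite pnatr_eq0 -lt0n sc_pos.
have q0 : q%:R != 0 :> C.
  by rewrite pnatr_eq0; apply: contraTneq (sc_pos s n) => q0; rewrite qE q0.
rewrite qE (sum_modn _ _ (fun k => f (iotaZS s k))) /riemannZS natrM.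
by field; rewrite sm0 q0.
Qed.

Lemma riemannZS_close f m e :
  (forall x y, sval y m = sval x m -> normc (f y - f x) <= e) ->
  forall n, (m <= n)%N -> normc (riemannZS f n - riemannZS f m) <= e.
Proof.
move=> fe n mn; rewrite (riemannZS_coarse f mn) /riemannZS -mulrBr -sumrB.
apply: (normc_mean_le (F := fun k => f (iotaZS s k) - f (iotaZS s (k %% s m)%N))).
  exact: sc_pos.
by move=> k _; apply: fe => /=; rewrite modn_mod.
Qed.

(** Uniform continuity makes the Riemann sums Cauchy, so the [limn] in the definition of [haarZS]
    are genuine limits and not default values. *)
Lemma haarZS_cvg f : contZS f -> cvgC (riemannZS f) (haarZS f).
Proof.
move=> cf; have [e e0|l fl] := @cvgC_cauchy R (riemannZS f); last first.
  by rewrite (haarZS_eq fl).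
have [m mP] := contZS_unif cf (divr_gt0 e0 (ltr0n R 2)).
exists m => n mn; have e2 : e / 2 < e by lra.
by apply: le_lt_trans _ e2; apply: riemannZS_close mn => x y /mP/ltW.
Qed.

Lemma haarZSD f g : contZS f -> contZS g ->
  haarZS (fun x => f x + g x) = haarZS f + haarZS g.
Proof.
move=> /haarZS_cvg cf /haarZS_cvg cg; apply: haarZS_eq.
have := cvgCD cf cg; congr cvgC; apply: funext => n.
by rewrite /riemannZS big_split mulrDr.
Qed.

Lemma haarZSZ (c : C) f : contZS f -> haarZS (fun x => c * f x) = c * haarZS f.
Proof.
move=> /haarZS_cvg cf; apply: haarZS_eq.
have := cvgCZ c cf; congr cvgC; apply: funext => n.
by rewrite /riemannZS -mulr_sumr mulrCA.
Qed.

Lemma haarZS_cst (c : C) : haarZS (fun _ : ZS s => c) = c.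
Proof.
apply: haarZS_eq; have := cvgC_cst c; congr cvgC; apply: funext => n.
rewrite /riemannZS sumr_const card_ord -(mulr_natl c) mulKf//.
by rewrite pnatr_eq0 -lt0n sc_pos.
Qed.

Lemma haarZS_sum (I : Type) (r : seq I) (F : I -> ZS s -> C) :
  (forall i, contZS (F i)) ->
  haarZS (fun x => \sum_(i <- r) F i x) = \sum_(i <- r) haarZS (F i).
Proof.
move=> cF; elim: r => [|i r IH].
  by rewrite big_nil; under eq_fun do rewrite big_nil; exact: haarZS_cst.
rewrite big_cons -IH -haarZSD//; last exact: contZS_sum.
by congr haarZS; apply: funext => x; rewrite big_cons.
Qed.

Lemma haarZS_conj f : contZS f -> haarZS (fun x => conjc (f x)) = conjc (haarZS f).
Proof.
move=> /haarZS_cvg cf; apply: haarZS_eq.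
have := cvgC_conj cf; congr cvgC; apply: funext => n.
by rewrite /riemannZS rmorphM rmorph_sum fmorphV rmorph_nat.
Qed.

Lemma haarZS_le f B : contZS f -> (forall x, normc (f x) <= B) -> normc (haarZS f) <= B.
Proof.
move=> /haarZS_cvg cf fB; apply: cvgC_norm_le cf _; exists 0%N => n _.
by apply: (normc_mean_le (F := fun k => f (iotaZS s k))); rewrite ?sc_pos.
Qed.

(** The Riemann sums of [f] and of its translate differ by a telescoping sum; only two boundary
    terms remain, and division by [s n] sends them to 0. *)
Lemma haarZS_shift1 f : contZS f -> haarZS (fun x => f (shiftZS 1 x)) = haarZS f.
Proof.
move=> cf; apply: haarZS_eq; apply: cvgC_squeeze (haarZS_cvg cf) _ => e e0.
have [B B0 fB] := contZS_bounded cf.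
(* As [n < s n], an index beyond [(B + B) / e] is large enough. *)
have [n0 n0B] : exists n0 : nat, (B + B) / e <= n0%:R.
  exists (Num.truncn ((B + B) / e)).+1.
  by rewrite ltW// truncnS_gt.
exists n0 => n n0n.
rewrite /riemannZS -mulrBr -sumrB.
under eq_bigr do rewrite shift_iotaZS addn1.
rewrite -(big_mkord xpredT (fun k => f (iotaZS s k.+1) - f (iotaZS s k))).
rewrite telescope_sumr ?leq0n//.
rewrite ComplexField.Normc.normcM ComplexField.Normc.normcV normc_nat.
rewrite mulrC ler_pdivrMr ?ltr0n ?sc_pos//.
apply: le_trans (normc_triangle _ _) _; rewrite normc_opp.
apply: le_trans (lerD (fB _) (fB _)) _.
rewrite -ler_pdivrMl// mulrC (le_trans n0B)// ler_nat.
by rewrite (leq_trans n0n)// ltnW// scale_gt.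
Qed.

Lemma haarZS_shift t f : contZS f -> haarZS (fun x => f (shiftZS t x)) = haarZS f.
Proof.
move=> cf; elim: t => [|t IH]; first by under eq_fun do rewrite shiftZS0.
rewrite -[RHS]IH -(haarZS_shift1 (contZS_shift t cf)).
by congr haarZS; apply: funext => x; rewrite shiftZSD.
Qed.

(** Translation by 1 multiplies the integral by [z] and leaves it unchanged, so it vanishes unless
    [z = 1]. *)
Lemma haarZS_chi (z : C) : dualZS s z -> haarZS (@chiZS R s z) = (z == 1)%:R.
Proof.
move=> dz; have [->|z1] := eqVneq z 1.
  by rewrite -[RHS](haarZS_cst 1); congr haarZS; apply: funext => x; rewrite chiZS1.
have := haarZS_shift 1 (contZS_chi dz).
under eq_fun do rewrite chiZS_shift// expr1.
rewrite haarZSZ; last exact: contZS_chi.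
move/eqP; rewrite -subr_eq0 -{2}[haarZS _]mul1r -mulrBl mulf_eq0 subr_eq0 (negPf z1).
by move/eqP.
Qed.

Section Fourier.
Implicit Types (z w : C).

Lemma contZS_fhat f z : contZS f -> dualZS s z ->
  contZS (fun x => f x * chiZS (conjc z) x).
Proof. by move=> cf dz; apply: contZSM => //; apply/contZS_chi/dualZS_conj. Qed.

Lemma fhatD f g z : contZS f -> contZS g -> dualZS s z ->
  fhat (fun x => f x + g x) z = fhat f z + fhat g z.
Proof.
move=> cf cg dz; rewrite /fhat -haarZSD; try exact: contZS_fhat.
by congr haarZS; apply: funext => x; rewrite mulrDl.
Qed.

Lemma fhatZ c f z : contZS f -> dualZS s z ->
  fhat (fun x => c * f x) z = c * fhat f z.
Proof.
move=> cf dz; rewrite /fhat -haarZSZ; last exact: contZS_fhat.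
by congr haarZS; apply: funext => x; rewrite mulrA.
Qed.

Lemma fhatB f g z : contZS f -> contZS g -> dualZS s z ->
  fhat (fun x => f x - g x) z = fhat f z - fhat g z.
Proof.
move=> cf cg dz; rewrite -[in RHS](mulN1r (fhat g z)) -fhatZ// -fhatD//.
  by congr fhat; apply: funext => x; rewrite mulN1r.
exact: contZSZ.
Qed.

Lemma fhat_conj f z : contZS f -> dualZS s z ->
  fhat (fun x => conjc (f x)) z = conjc (fhat f (conjc z)).
Proof.
move=> cf dz; rewrite /fhat -haarZS_conj; last first.
  by apply: contZS_fhat => //; exact: dualZS_conj.
congr haarZS; apply: funext => x; rewrite rmorphM; congr (_ * _).
case: dz => m zm.
have zm' : conjc z ^+ s m = 1 by rewrite -rmorphXn zm rmorph1.
by rewrite conjcK (chiZS_eq _ zm) (chiZS_eq _ zm') rmorphXn.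
Qed.

Lemma fhat_le f z B : contZS f -> dualZS s z -> (forall x, normc (f x) <= B) ->
  normc (fhat f z) <= B.
Proof.
move=> cf dz fB; apply: haarZS_le; first exact: contZS_fhat.
move=> x; rewrite ComplexField.Normc.normcM normc_chi ?mulr1//.
exact: dualZS_conj.
Qed.

(** Translation invariance applied to [f] times the conjugate character; the factor that the
    character picks up is the inverse of [z ^+ t]. *)
Lemma fhat_shift f z t : contZS f -> dualZS s z ->
  fhat (fun x => f (shiftZS t x)) z = z ^+ t * fhat f z.
Proof.
move=> cf dz; rewrite /fhat -(haarZS_shift t (contZS_fhat cf dz)) -haarZSZ; last first.
  by have := contZS_shift t (contZS_fhat cf dz).
congr haarZS; apply: funext => x; rewrite chiZS_shift; last exact: dualZS_conj.
rewrite mulrCA [z ^+ t * _]mulrA -exprMn (dualZS_conjV dz) divff ?expr1n ?mul1r//.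
exact: dualZS_neq0 dz.
Qed.

Lemma fhat_chi z w : dualZS s z -> dualZS s w ->
  fhat (@chiZS R s w) z = (w == z)%:R.
Proof.
move=> dz dw; rewrite /fhat; under eq_fun do rewrite (chiZSM _ dw (dualZS_conj dz)).
rewrite haarZS_chi; last by apply/dualZSM/dualZS_conj.
by rewrite (dualZS_conjV dz) (can2_eq (divfK (dualZS_neq0 dz)) (mulfK (dualZS_neq0 dz))) mul1r.
Qed.

Lemma fhat_sum (I : Type) (r : seq I) (F : I -> ZS s -> C) z :
  (forall i, contZS (F i)) -> dualZS s z ->
  fhat (fun x => \sum_(i <- r) F i x) z = \sum_(i <- r) fhat (F i) z.
Proof.
move=> cF dz; rewrite /fhat -haarZS_sum; last by move=> i; exact: contZS_fhat.
by congr haarZS; apply: funext => x; rewrite mulr_suml.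
Qed.

End Fourier.
End Haar.

(** * Uniform convergence of Fourier sums over roots of unity *)

Section FourierSums.
Variables (R : realType) (s : scale).
Local Notation C := R[i].
Local Notation normc := (@ComplexField.Normc.normc R).
Implicit Types (f g : ZS s -> C) (x y : ZS s) (e B : R) (z w : C).

(** Used with [w] a primitive root of order [s m], whose powers list the finite subgroup of the
    [s m]-th roots of unity once each. *)
Definition fourier_sum w m f x : C :=
  \sum_(i < s m) fhat f (w ^+ i) * chiZS (w ^+ i) x.

Lemma prim_root_dual w m i : (s m).-primitive_root w -> dualZS s (w ^+ i).
Proof.
by move=> pw; exists m; rewrite exprAC (prim_expr_order pw) expr1n.
Qed.

Lemma sum_unity z n : z ^+ n = 1 -> z != 1 -> \sum_(i < n) z ^+ i = 0.
Proof.
move=> zn z1; have := subrX1 z n; rewrite zn subrr => /esym/eqP.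
by rewrite mulf_eq0 subr_eq0 (negPf z1) => /eqP.
Qed.

(** A geometric sum in [u], the power of [w] with exponent the difference of the two residues; [u]
    is an [s m]-th root of unity, and [u = 1] only when the residues agree. *)
Lemma dirichlet_kernel w m x y : (s m).-primitive_root w ->
  \sum_(i < s m) chiZS (w ^+ i) x * chiZS (conjc (w ^+ i)) y
  = (s m * (sval y m == sval x m))%:R.
Proof.
move=> pw; have w0 : w != 0 by have := dualZS_neq0 (prim_root_dual 1 pw).
pose u := w ^+ sval x m / w ^+ sval y m.
have -> : \sum_(i < s m) chiZS (w ^+ i) x * chiZS (conjc (w ^+ i)) y = \sum_(i < s m) u ^+ i.
  apply: eq_bigr => i _; have di := prim_root_dual i pw.
  have wi : (w ^+ i) ^+ s m = 1 by rewrite exprAC (prim_expr_order pw) expr1n.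
  rewrite (dualZS_conjV di) (chiZS_eq _ wi) (@chiZS_eq _ _ _ m) ?exprVn ?wi ?invr1//.
  by rewrite /u expr_div_n -!exprM ![(_ * i)%N]mulnC.
have [yx|yx] := eqVneq (sval y m) (sval x m).
  rewrite muln1 /u yx divff ?expf_neq0//.
  by under eq_bigr do rewrite expr1n; rewrite sumr_const card_ord.
rewrite muln0 sum_unity//.
  by rewrite /u expr_div_n !(exprAC _ _ (s m)) (prim_expr_order pw) !expr1n divr1.
apply: contra yx; rewrite /u (can2_eq (divfK (expf_neq0 _ w0)) (mulfK (expf_neq0 _ w0))) mul1r.
by rewrite (eq_prim_root_expr pw) !modn_small ?ZS_ltn// eq_sym.
Qed.

(** The triangle inequality for Riemann sums, passed to the limit. *)
Lemma haarZS_dom f (k : ZS s -> R) : contZS f -> contZS (fun x => (k x)%:C%C) ->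
  (forall x, normc (f x) <= k x) ->
  normc (haarZS f) <= complex.Re (haarZS (fun x => (k x)%:C%C)).
Proof.
move=> cf ck fk; apply/ler_addgt0Pr => e e0.
have [n0 h] := haarZS_cvg ck e0.
apply: cvgC_norm_le (haarZS_cvg cf) _; exists n0 => n /h nP.
have /le_trans : normc (riemannZS f n) <= complex.Re (riemannZS (fun x => (k x)%:C%C) n).
  rewrite /riemannZS -rmorph_sum -(rmorph_nat (real_complex R)) -fmorphV -rmorphM/=.
  rewrite ComplexField.Normc.normcM normc_real ger0_norm ?invr_ge0//.
  by rewrite ler_wpM2l ?invr_ge0// (le_trans (normc_sum _ _ _))// ler_sum.
apply; rewrite -lerBlDl -raddfB.
exact/ltW/(le_lt_trans (ler_norm _))/(le_lt_trans (normc_geRe _)).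
Qed.

(* The partial sum is the average of [f] against the Dirichlet kernel, which is
   [s m] times the indicator of the cylinder through [x]. *)
Lemma fourier_sum_close w m f x e : (s m).-primitive_root w -> contZS f -> 0 <= e ->
  (forall y, sval y m = sval x m -> normc (f y - f x) <= e) ->
  normc (fourier_sum w m f x - f x) <= e.
Proof.
move=> pw cf e0 fe; have di i := prim_root_dual i pw.
pose K i y := chiZS (w ^+ i) x * chiZS (conjc (w ^+ i)) y.
have cK i : contZS (K i) by apply/contZSZ/contZS_chi/dualZS_conj/di.
have csK : contZS (fun y => \sum_(i < s m) K i y) by exact: contZS_sum.
have hKi i : haarZS (K i) = chiZS (w ^+ i) x * (s m %| i)%:R.
  rewrite /K haarZSZ ?haarZS_chi; [|exact/dualZS_conj/di|exact/contZS_chi/dualZS_conj/di].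
  by rewrite (dualZS_conjV (di i)) invr_eq1 (prim_order_dvd pw).
(* Only the trivial character, [i = 0], has a nonzero integral. *)
have hK : haarZS (fun y => \sum_(i < s m) K i y) = 1.
  rewrite haarZS_sum// (bigD1 (Ordinal (sc_pos s m)))//= big1 ?addr0.
    by rewrite hKi expr0 chiZS1 dvdn0 mulr1.
  move=> i i0; rewrite hKi gtnNdvd ?mulr0//.
  by rewrite lt0n; apply: contra i0 => /eqP i0; apply/eqP/val_inj.
pose k y : R := (s m * (sval y m == sval x m))%:R.
have kE : (fun y => (k y)%:C%C) = fun y => \sum_(i < s m) K i y.
  by apply: funext => y; rewrite dirichlet_kernel// rmorph_nat.
(* Because the kernel has mass 1, [f x] can be moved under the integral. *)
have -> : fourier_sum w m f x - f x = haarZS (fun y => (f y - f x) * \sum_(i < s m) K i y).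
  have -> : fourier_sum w m f x = haarZS (fun y => f y * \sum_(i < s m) K i y).
    have -> : (fun y => f y * \sum_(i < s m) K i y) = fun y => \sum_(i < s m) f y * K i y.
      by apply: funext => y; rewrite mulr_sumr.
    rewrite /fourier_sum haarZS_sum; last by move=> i; exact: contZSM.
    apply: eq_bigr => i _; rewrite mulrC -haarZSZ; last exact/contZS_fhat/di.
    by congr haarZS; apply: funext => y; rewrite mulrCA.
  rewrite -{1}[f x]mulr1 -hK -mulN1r mulrA mulN1r -haarZSZ// -haarZSD; [|exact: contZSM|exact: contZSZ].
  by congr haarZS; apply: funext => y; rewrite mulrBl mulNr.
have kEy y : \sum_(i < s m) K i y = (k y)%:C%C by exact: esym (congr1 (fun h => h y) kE).
under eq_fun do rewrite kEy.
rewrite -kE in csK hK.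
have ck : contZS (fun y => (e * k y)%:C%C).
  by under eq_fun do rewrite rmorphM; exact: contZSZ.
have he : haarZS (fun y => (e * k y)%:C%C) = e%:C%C.
  by rewrite -[RHS]mulr1 -hK -haarZSZ//; congr haarZS; apply: funext => y; rewrite rmorphM.
have ch : contZS (fun y => (f y - f x) * (k y)%:C%C).
  by apply: contZSM => //; apply: contZSB => //; exact: contZS_cst.
(* The kernel is nonnegative and vanishes off the cylinder of [x], where [f] is within [e] of [f x];
   so [e * k] dominates the integrand, and its integral is [e]. *)
apply: le_trans (haarZS_dom ch ck _) _; last by rewrite he.
move=> y; rewrite ComplexField.Normc.normcM normc_real ger0_norm ?ler0n//.
rewrite /k; have [yx|] := eqVneq (sval y m); last by rewrite muln0 !mulr0.
by rewrite ler_wpM2r ?ler0n// fe.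
Qed.

Lemma fourier_sum_cvg f e : contZS f -> 0 < e ->
  exists m0, forall m w, (m0 <= m)%N -> (s m).-primitive_root w ->
    forall x, normc (fourier_sum w m f x - f x) <= e.
Proof.
move=> cf e0; have [m0 mP] := contZS_unif cf e0.
exists m0 => m w m0m pw x; apply: fourier_sum_close => //; first exact: ltW.
by move=> y /(ZS_eq_le m0m)/mP/ltW.
Qed.

End FourierSums.

(** * The weighted norms, handled through their finite partial sums *)

Section Norms.
Variables (R : realType) (s : scale) (lam : R[i] -> R).
Local Notation C := R[i].
Local Notation normc := (@ComplexField.Normc.normc R).
Implicit Types (f g : ZS s -> C) (x y : ZS s) (e B : R) (z w : C) (l : seq C).

#[local] Arguments ComplexField.Normc.normc : simpl never.

(** The inequality [normN lam N f <= B] stated on finite sums, which keeps the estimates in the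
    reals; see [normN_leP]. *)
Definition norm_bounded N f B := forall l, uniq l ->
  (forall z, z \in l -> dualZS s z) -> \sum_(z <- l) normc (fhat f z) * lam z ^+ N <= B.

Lemma normN_leP N f B : (normN lam N f <= B%:E)%E <-> norm_bounded N f B.
Proof.
split=> [fB l ul dl|fB].
  rewrite -lee_fin; apply: le_trans fB; rewrite /normN /esum.
  apply: ereal_sup_ubound; exists [set` l].
    by split; [exact: finite_seq|move=> z; exact: dl].
  by rewrite -fsbig_seq// sumEFin.
apply: ge_ereal_sup => _ [X [finX dX] <-].
rewrite fsbig_finite//= sumEFin lee_fin; apply: fB => [|z]; first exact: finmap.fset_uniq.
by rewrite in_fset_set// inE; exact: dX.
Qed.

Hypothesis lamP : length_fn s lam.

Lemma lam_ge1 z : dualZS s z -> 1 <= lam z.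
Proof. by case: lamP => h _; exact: h. Qed.

Lemma lam_gt0 z : dualZS s z -> 0 < lam z.
Proof. by move=> /lam_ge1; exact: lt_le_trans. Qed.

Lemma lamX_ge0 N z : dualZS s z -> 0 <= lam z ^+ N.
Proof. by move=> /lam_gt0/ltW; exact: exprn_ge0. Qed.

Lemma lamM z w : dualZS s z -> dualZS s w -> lam (z * w) <= Num.max (lam z) (lam w).
Proof. by case: lamP => _ [_] [h _]; exact: h. Qed.

Lemma lam1 : lam 1 = 1.
Proof. by case: lamP => _ [h _]; apply/h => //; exact: dualZS1. Qed.

Lemma lamX z k : dualZS s z -> lam (z ^+ k) <= lam z.
Proof.
move=> dz; elim: k => [|k IH]; first by rewrite lam1 lam_ge1.
rewrite exprS (le_trans (lamM dz (dualZSX k dz)))//.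
by rewrite ge_max lexx IH.
Qed.

(** The conjugate of a root of unity is its inverse, hence one of its powers, so [lamX] gives one
    inequality; conjugating again gives the other. *)
Lemma lam_conj z : dualZS s z -> lam (conjc z) = lam z.
Proof.
have h w : dualZS s w -> lam (conjc w) <= lam w.
  move=> dw; case: (dw) => m wm; suff -> : conjc w = w ^+ (s m).-1 by exact: lamX.
  rewrite (dualZS_conjV dw); apply: (mulfI (dualZS_neq0 dw)).
  by rewrite divff ?(dualZS_neq0 dw)// -exprS prednK ?sc_pos.
move=> dz; apply/eqP; rewrite eq_le h//=.
by rewrite -{1}[z]conjcK h//; exact: dualZS_conj.
Qed.

Lemma norm_bounded_ge0 N f B : norm_bounded N f B -> 0 <= B.
Proof. by move=> /(_ [::] isT); rewrite big_nil; apply. Qed.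

Lemma norm_bounded_le N f B B' : B <= B' -> norm_bounded N f B -> norm_bounded N f B'.
Proof. by move=> BB' fB l ul dl; apply: le_trans BB'; exact: fB. Qed.

Lemma norm_bounded0 N f B : norm_bounded N f B -> norm_bounded 0 f B.
Proof.
move=> fB l ul dl; apply: le_trans (fB l ul dl).
rewrite big_seq [leRHS]big_seq; apply: ler_sum => z /dl dz.
by rewrite ler_wpM2l ?normc_ge0// expr0 exprn_ege1 ?lam_ge1.
Qed.

Lemma norm_boundedD N f g B B' : contZS f -> contZS g ->
  norm_bounded N f B -> norm_bounded N g B' ->
  norm_bounded N (fun x => f x + g x) (B + B').
Proof.
move=> cf cg fB gB l ul dl; apply: le_trans (lerD (fB l ul dl) (gB l ul dl)).
rewrite -big_split big_seq [leRHS]big_seq; apply: ler_sum => z /dl dz /=.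
by rewrite (fhatD cf cg dz) -mulrDl ler_wpM2r ?normc_triangle// lamX_ge0.
Qed.

Lemma norm_boundedZ N (a : C) f B : contZS f -> norm_bounded N f B ->
  norm_bounded N (fun x => a * f x) (normc a * B).
Proof.
move=> cf fB l ul dl; apply: le_trans (ler_wpM2l (normc_ge0 a) (fB l ul dl)).
rewrite mulr_sumr big_seq [leRHS]big_seq; apply: ler_sum => z /dl dz /=.
by rewrite (fhatZ a cf dz) ComplexField.Normc.normcM mulrA.
Qed.

Lemma norm_boundedB N f g B B' : contZS f -> contZS g ->
  norm_bounded N f B -> norm_bounded N g B' ->
  norm_bounded N (fun x => f x - g x) (B + B').
Proof.
move=> cf cg fB gB l ul dl; apply: le_trans (lerD (fB l ul dl) (gB l ul dl)).
rewrite -big_split big_seq [leRHS]big_seq; apply: ler_sum => z /dl dz /=.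
rewrite (fhatB cf cg dz) -mulrDl ler_wpM2r ?lamX_ge0//.
by rewrite (le_trans (normc_triangle _ _))// normc_opp.
Qed.

(** Conjugation permutes the dual and preserves [lam], so the sum over [l] for the conjugate
    function is the sum over the conjugate list for [f]. *)
Lemma norm_bounded_conj N f B : contZS f -> norm_bounded N f B ->
  norm_bounded N (fun x => conjc (f x)) B.
Proof.
move=> cf fB l ul dl.
have := fB (map (@conjc R) l); rewrite (map_inj_uniq (can_inj (@conjcK _))) big_map.
move=> /(_ ul) h; apply: le_trans (h _); last first.
  by move=> z /mapP[w /dl dw ->]; exact: dualZS_conj.
rewrite big_seq [leRHS]big_seq le_eqVlt; apply/orP/or_introl/eqP.
by apply: eq_bigr => z /dl dz; rewrite fhat_conj// normc_conj lam_conj.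
Qed.

Lemma norm_bounded_chi N w : dualZS s w -> norm_bounded N (@chiZS R s w) (lam w ^+ N).
Proof.
move=> dw l ul dl.
have -> : \sum_(z <- l) normc (fhat (@chiZS R s w) z) * lam z ^+ N =
    \sum_(z <- l) (w == z)%:R * lam w ^+ N.
  rewrite big_seq [RHS]big_seq; apply: eq_bigr => z /dl dz.
  by rewrite fhat_chi// normc_nat; case: eqP => [->|]; rewrite ?mul0r.
rewrite -mulr_suml ler_piMl ?lamX_ge0//.
have [wl|wl] := boolP (w \in l); last first.
  rewrite big_seq big1// => z zl; rewrite (_ : (w == z) = false)//.
  by apply: contraNF wl => /eqP ->.
rewrite (bigD1_seq w)//= eqxx big1 ?addr0// => z zw.
by rewrite eq_sym (negPf zw).
Qed.

Lemma norm_bounded_sum N (I : Type) (r : seq I) (F : I -> ZS s -> C) (B : I -> R) :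
  (forall i, contZS (F i)) -> (forall i, norm_bounded N (F i) (B i)) ->
  norm_bounded N (fun x => \sum_(i <- r) F i x) (\sum_(i <- r) B i).
Proof.
move=> cF FB l ul dl.
apply: le_trans (ler_sum r (fun i (_ : true) => FB i l ul dl)).
rewrite exchange_big/= big_seq [leRHS]big_seq; apply: ler_sum => z /dl dz.
by rewrite -mulr_suml ler_wpM2r ?lamX_ge0// fhat_sum// normc_sum.
Qed.

(** Fatou's lemma: for a fixed finite list, uniform approximation moves each coefficient by little,
    so a common bound on the approximants survives in the limit. *)
Lemma norm_bounded_limit N f B : contZS f ->
  (forall e, 0 < e -> exists g, [/\ contZS g, norm_bounded N g B &
     forall x, normc (f x - g x) <= e]) ->
  norm_bounded N f B.
Proof.
move=> cf fg l ul dl; apply/ler_addgt0Pr => e e0.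
pose L := \sum_(z <- l) lam z ^+ N.
have L0 : 0 <= L.
  by rewrite /L big_seq; apply: sumr_ge0 => z /dl dz; exact: lamX_ge0.
have L1 : 0 < L + 1 by rewrite ltr_wpDl.
(* [L] is the total weight of the list, so this tolerance costs at most [e]. *)
have [g [cg gB gP]] := fg _ (divr_gt0 e0 L1).
apply: (@le_trans _ _ (B + e / (L + 1) * L)); last first.
  by rewrite lerD2l -mulrA ler_piMr ?ltW// mulrC ltr_pdivrMr// mul1r ltrDl.
apply: le_trans (lerD (gB l ul dl) (lexx _)).
rewrite mulr_sumr -big_split big_seq [leRHS]big_seq; apply: ler_sum => z /dl dz /=.
rewrite -mulrDl ler_wpM2r ?lamX_ge0//.
rewrite -{1}(subrK (fhat g z) (fhat f z)) addrC (le_trans (normc_triangle _ _))// lerD2l.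
by rewrite -fhatB//; apply: fhat_le => //; exact: contZSB.
Qed.

End Norms.

(** * Submultiplicativity, and coefficient decay by translation *)

Section Algebra.
Variables (R : realType) (s : scale) (lam : R[i] -> R).
Local Notation C := R[i].
Local Notation normc := (@ComplexField.Normc.normc R).
Implicit Types (f g : ZS s -> C) (x y : ZS s) (e B : R) (z w : C) (l : seq C).
Hypothesis lamP : length_fn s lam.
#[local] Arguments ComplexField.Normc.normc : simpl never.

Lemma prim_root_norm_sum N f B m w : (s m).-primitive_root w -> norm_bounded lam N f B ->
  \sum_(i < s m) normc (fhat f (w ^+ i)) * lam (w ^+ i) ^+ N <= B.
Proof.
move=> pw fB; have := fB [seq w ^+ (val i) | i : 'I_(s m)].
rewrite big_map big_enum/=; apply.
  rewrite map_inj_uniq ?enum_uniq// => i j /eqP.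
  by rewrite (eq_prim_root_expr pw) !modn_small ?ltn_ord// => /eqP/val_inj.
by move=> z /mapP[i _ ->]; exact: prim_root_dual pw.
Qed.

Lemma normc_fourier_sum N f B m w x : (s m).-primitive_root w -> norm_bounded lam N f B ->
  normc (fourier_sum w m f x) <= B.
Proof.
move=> pw /(norm_bounded0 lamP)/(prim_root_norm_sum pw); apply: le_trans.
rewrite (le_trans (normc_sum _ _ _))// ler_sum// => i _.
by rewrite ComplexField.Normc.normcM normc_chi ?expr0//; exact: prim_root_dual pw.
Qed.

(** The Fourier sums are bounded by [B], as characters have modulus 1 and weights are at least 1,
    and they converge uniformly to [f]. *)
Lemma normc_le_norm N f B x : contZS f -> norm_bounded lam N f B -> normc (f x) <= B.
Proof.
move=> cf fB; apply/ler_addgt0Pr => e e0.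
have [m mP] := fourier_sum_cvg cf e0; have [w pw] := primitive_rootC R (sc_pos s m).
have := mP m w (leqnn _) pw x; rewrite normcB => h.
rewrite -(subrK (fourier_sum w m f x) (f x)) addrC.
by rewrite (le_trans (normc_triangle _ _))// lerD// (normc_fourier_sum _ pw fB).
Qed.

(** The product expands into characters indexed by products of roots, and the resulting double sum
    is dominated by the product of the two weighted sums. *)
Lemma norm_bounded_fourierM N f g B B' m w : (s m).-primitive_root w ->
  norm_bounded lam N f B -> norm_bounded lam N g B' ->
  norm_bounded lam N (fun x => fourier_sum w m f x * fourier_sum w m g x) (B * B').
Proof.
move=> pw fB gB; have d i := prim_root_dual i pw.
have -> : (fun x => fourier_sum w m f x * fourier_sum w m g x) = fun x =>
    \sum_(i < s m) \sum_(j < s m)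
       (fhat f (w ^+ i) * fhat g (w ^+ j)) * chiZS (w ^+ i * w ^+ j) x.
  apply: funext => x; rewrite /fourier_sum big_distrlr; apply: eq_bigr => i _ /=.
  by apply: eq_bigr => j _; rewrite mulrACA (chiZSM _ (d i) (d j)).
have dd i j : dualZS s (w ^+ i * w ^+ j) by exact: dualZSM.
have cc i j : contZS (fun x => (fhat f (w ^+ i) * fhat g (w ^+ j)) * chiZS (w ^+ i * w ^+ j) x).
  by apply: contZSZ; exact: contZS_chi.
have fg0 i j := normc_ge0 (fhat f (w ^+ i) * fhat g (w ^+ j)).
apply: (@norm_bounded_le _ _ _ _ _ (\sum_(i < s m) \sum_(j < s m)
    normc (fhat f (w ^+ i) * fhat g (w ^+ j)) * lam (w ^+ i * w ^+ j) ^+ N)); last first.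
  apply: (norm_bounded_sum lamP) => i.
    by apply: contZS_sum => j; exact: cc.
  apply: (norm_bounded_sum lamP) => j; first exact: cc.
  by apply: norm_boundedZ; [exact: contZS_chi|exact: norm_bounded_chi].
apply: le_trans (ler_pM _ _ (prim_root_norm_sum pw fB) (prim_root_norm_sum pw gB)).
- rewrite big_distrlr; apply: ler_sum => i _; apply: ler_sum => j _ /=.
 rewrite ComplexField.Normc.normcM mulrACA ler_wpM2l ?mulr_ge0 ?normc_ge0//.
  rewrite -exprMn lerXn2r ?nnegrE ?mulr_ge0 ?(ltW (lam_gt0 lamP (d _))) ?(ltW (lam_gt0 lamP (dd _ _)))//.
  apply: le_trans (lamM lamP (d i) (d j)) _.
  (* Both lengths are at least 1, so their maximum is at most their product. *)
  have li := lam_ge1 lamP (d i); have lj := lam_ge1 lamP (d j).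
  by rewrite ge_max ler_peMr// ?ler_peMl// (le_trans ler01).
- by apply: sumr_ge0 => i _; rewrite mulr_ge0 ?normc_ge0 ?(lamX_ge0 lamP).
- by apply: sumr_ge0 => i _; rewrite mulr_ge0 ?normc_ge0 ?(lamX_ge0 lamP).
Qed.

(** Fatou's lemma applied to products of Fourier sums, in place of a convolution of infinite
    series. *)
Lemma norm_boundedM N f g B B' : contZS f -> contZS g ->
  norm_bounded lam N f B -> norm_bounded lam N g B' ->
  norm_bounded lam N (fun x => f x * g x) (B * B').
Proof.
move=> cf cg fB gB; apply: (norm_bounded_limit lamP); first exact: contZSM.
move=> e e0; have B0 := norm_bounded_ge0 fB; have B'0 := norm_bounded_ge0 gB.
have BB1 : 0 < B + B' + 1 by rewrite ltr_wpDl// addr_ge0.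
(* With both factors approximated within [d], the product is off by at most [d * B' + B * d]. *)
have d0 := divr_gt0 e0 BB1; set d := e / _ in d0.
have [m1 h1] := fourier_sum_cvg cf d0; have [m2 h2] := fourier_sum_cvg cg d0.
pose m := maxn m1 m2; have [w pw] := primitive_rootC R (sc_pos s m).
have {}h1 x := h1 m w (leq_maxl _ _) pw x; have {}h2 x := h2 m w (leq_maxr _ _) pw x.
have cF (h : ZS s -> C) : contZS (fourier_sum w m h).
  by apply: contZS_sum => i; apply: contZSZ; exact: contZS_chi (prim_root_dual i pw).
exists (fun x => fourier_sum w m f x * fourier_sum w m g x); split.
- exact: contZSM.
- exact: norm_bounded_fourierM.
- move=> x.
  have -> : f x * g x - fourier_sum w m f x * fourier_sum w m g x =
    (f x - fourier_sum w m f x) * g x + fourier_sum w m f x * (g x - fourier_sum w m g x) by ring.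
  apply: le_trans (normc_triangle _ _) _; rewrite !ComplexField.Normc.normcM.
  have := h1 x; have := h2 x; rewrite ![normc (fourier_sum _ _ _ _ - _)]normcB => h2x h1x.
  apply: (@le_trans _ _ (d * B' + B * d)).
    apply: lerD; apply: ler_pM; rewrite ?normc_ge0//.
      exact: normc_le_norm gB.
    exact: normc_fourier_sum pw fB.
  by rewrite mulrC -mulrDl addrC /d mulrC -mulrA ler_piMr ?ltW// mulrC ltr_pdivrMr// mul1r ltrDl.
Qed.

Lemma normN_fin_num N f : CRD lam f -> normN lam N f \is a fin_num.
Proof.
move=> [_ /(_ N) foo]; rewrite ge0_fin_numE//.
by apply: esum_ge0 => z dz; rewrite lee_fin mulr_ge0 ?normc_ge0 ?(lamX_ge0 lamP).
Qed.

Lemma norm_bounded_normN N f : CRD lam f -> norm_bounded lam N f (fine (normN lam N f)).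
Proof. by move=> fC; apply/normN_leP; rewrite fineK// normN_fin_num. Qed.

Lemma CRDP f : CRD lam f <->
  contZS f /\ forall N, exists B, norm_bounded lam N f B.
Proof.
split=> [fC|[cf h]].
  by split=> [|N]; [case: fC|exists (fine (normN lam N f)); exact: norm_bounded_normN].
split=> // N; have [B /normN_leP] := h N.
by move/le_lt_trans; apply; exact: ltry.
Qed.

(** The difference has coefficients [(z ^+ (n * k) - 1) * fhat f z]. They vanish where [z ^+ n = 1];
    elsewhere [lam z >= r], and the factor 2 is paid for by [lam z ^+ N / r ^+ N]. The sup norm is
    then bounded by the norm of index 0. *)
Lemma translate_close N f B n (r : R) k x : contZS f -> norm_bounded lam N f B -> 0 < r ->
  (forall w, dualZS s w -> w ^+ n = 1 \/ r <= lam w) ->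
  normc (f (shiftZS (n * k) x) - f x) <= 2 * B / r ^+ N.
Proof.
move=> cf fB r0 nr; have rN : 0 < r ^+ N by rewrite exprn_gt0.
have ct := contZS_shift (n * k) cf.
apply: (@normc_le_norm 0 (fun x => f (shiftZS (n * k) x) - f x)); first exact: contZSB.
move=> l ul dl; rewrite mulrAC.
apply: le_trans (ler_wpM2l (divr_ge0 (ler0n R 2) (ltW rN)) (fB l ul dl)).
rewrite mulr_sumr big_seq [leRHS]big_seq; apply: ler_sum => z /dl dz.
rewrite (fhatB ct cf dz) (fhat_shift _ cf dz) expr0 mulr1.
rewrite -{2}[fhat f z]mul1r -mulrBl ComplexField.Normc.normcM mulrC mulrCA.
rewrite ler_wpM2l ?normc_ge0//; case: (nr z dz) => [zn|rz].
  rewrite exprM zn expr1n subrr ComplexField.Normc.normc0.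
  by rewrite mulr_ge0 ?divr_ge0 ?(lamX_ge0 lamP)// ltW.
rewrite mulrAC ler_pdivlMr// ler_pM ?normc_ge0//; first exact: ltW.
  rewrite (le_trans (normc_triangle _ _))// normc_opp normcX (dualZS_normc dz).
  by rewrite expr1n ComplexField.Normc.normc1.
by rewrite lerXn2r ?nnegrE ?(ltW r0) ?(ltW (lam_gt0 lamP dz)).
Qed.

(* Averaging [z ^+ (n * k)] over [k] gives 0, so the average of the translates
   of [g] by multiples of [n] has vanishing [z]-coefficient. *)
Lemma fhat_le_translates g z n e : contZS g -> dualZS s z -> z ^+ n != 1 ->
  (forall k x, normc (g (shiftZS (n * k) x) - g x) <= e) ->
  normc (fhat g z) <= e.
Proof.
move=> cg dz zn ge; case: (dz) => m zm.
have sm0 : (s m)%:R != 0 :> C by rewrite pnatr_eq0 -lt0n sc_pos.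
have fhatE k : fhat (fun x => g (shiftZS (n * k) x) - g x) z = (z ^+ n) ^+ k * fhat g z - fhat g z.
  by rewrite (fhatB (contZS_shift _ cg) cg dz) (fhat_shift _ cg dz) exprM.
rewrite -normc_opp.
have -> : - fhat g z =
    (s m)%:R^-1 * \sum_(k < s m) fhat (fun x => g (shiftZS (n * k) x) - g x) z.
  under eq_bigr do rewrite fhatE.
  rewrite sumrB -mulr_suml sum_unity//; last by rewrite exprAC zm expr1n.
  by rewrite mul0r sub0r sumr_const card_ord -(mulr_natl (fhat g z)) mulrN mulKf.
apply: (normc_mean_le (F := fun k => fhat (fun x => g (shiftZS (n * k) x) - g x) z)).
  exact: sc_pos.
by move=> k _; apply: fhat_le => //; apply: contZSB => //; exact: contZS_shift.
Qed.

(* By the ultrametric inequality, the [w] with [lam w < lam z] form a finite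
   group [V] not containing [z]; its order [n] works, as [V] exhausts the [n]-th
   roots of unity. *)
Lemma separating_exponent z : dualZS s z -> z != 1 ->
  exists n, z ^+ n != 1 /\ forall w, dualZS s w -> w ^+ n = 1 \/ lam z <= lam w.
Proof.
move=> dz z1; have lz1 : 1 < lam z.
  rewrite lt_neqAle (lam_ge1 lamP dz) andbT eq_sym.
  by case: lamP => _ [/(_ z dz) h _]; apply: contra z1 => /eqP/h/eqP.
pose V : set C := [set w | dualZS s w /\ lam w < lam z].
have finV : finite_set V.
  case: lamP => _ [_ [_ /(_ (lam z) (ltW lz1))]]; apply: sub_finite_set.
  by move=> w [dw /ltW].
have [l [ul lV]] : exists l : seq C, uniq l /\ forall w, w \in l <-> V w.
  have /finite_seqP[r Vr] := finV; exists (undup r); split; first exact: undup_uniq.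
  by move=> w; rewrite mem_undup Vr.
have V1 : 1 \in l by apply/lV; split; [exact: dualZS1|rewrite (lam1 lamP)].
have n0 : (0 < size l)%N by case: (l) V1.
have Vroot w : w \in l -> w ^+ size l = 1.
  move=> /lV[dw lw]; have w0 := dualZS_neq0 dw.
  (* Multiplication by [w] permutes the finite group, so the product of all elements equals itself
     times [w ^+ size l]. *)
  have pl : perm_eq (map ( *%R w) l) l.
    apply: uniq_perm => //; first by rewrite map_inj_uniq//; exact: mulfI.
    have sub : {subset map ( *%R w) l <= l}.
      move=> _ /mapP[v /lV[dv lv] ->]; apply/lV; split; first exact: dualZSM.
      by rewrite (le_lt_trans (lamM lamP dw dv))// gt_max lw lv.
    have uw : uniq (map ( *%R w) l) by rewrite map_inj_uniq//; exact: mulfI.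
    by have [] := uniq_min_size uw sub; rewrite ?size_map.
  have p0 : \prod_(v <- l) v != 0.
    by rewrite prodf_seq_neq0; apply/allP => v /lV[dv _]; exact: dualZS_neq0 dv.
  apply: (mulIf p0); rewrite mul1r -{2}(perm_big _ pl) big_map big_split/=.
  by rewrite big_const_seq count_predT iter_mulr_1.
exists (size l); split.
  (* Otherwise [z] together with [l] would give more roots of unity of exponent [size l] than the
     degree allows. *)
  apply/eqP => zn; have : (size (z :: l) <= size l)%N.
    apply: max_unity_roots => //=.
      apply/andP; split; first by apply/unity_rootP.
      by apply/allP => w /Vroot wn; apply/unity_rootP.
    by rewrite ul andbT; apply/negP => /lV[_]; rewrite ltxx.
  by rewrite ltnn.
move=> w dw; have [|lwz] := leP (lam z) (lam w); first by right.
by left; apply/Vroot/lV.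
Qed.

End Algebra.

(** * Fast growth makes a negative power of the length summable *)

Section Summability.
Variables (R : realType) (s : scale) (lam : R[i] -> R).
Local Notation C := R[i].
Local Notation normc := (@ComplexField.Normc.normc R).
Implicit Types (f g : ZS s -> C) (x y : ZS s) (e B : R) (z w : C) (l : seq C).
#[local] Arguments ComplexField.Normc.normc : simpl never.

Lemma sum_inv_sqr_le2 n : \sum_(k < n) (k.+1%:R ^- 2 : R) <= 2.
Proof.
case: n => [|n]; first by rewrite big_ord0.
(* The sharper bound is the one that goes through by induction. *)
apply: (@le_trans _ _ (2 - n.+1%:R^-1)); last by rewrite gerBl invr_ge0.
elim: n => [|n IH].
  by rewrite big_ord1/= expr1n invr1 lerBrDr -mulr2n.
rewrite big_ord_recr/=; apply: le_trans (lerD IH (lexx _)) _.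
have n0 : 0 < n.+1%:R :> R by rewrite ltr0n.
rewrite -[n.+2%:R]natr1; set t : R := n.+1%:R in n0 *.
have t1 : 0 < t + 1 by lra.
rewrite -subr_ge0.
have -> : 2 - (t + 1)^-1 - (2 - t^-1 + (t + 1) ^- 2) = (t * (t + 1) ^+ 2)^-1.
  by field; rewrite !gt_eqF.
by rewrite invr_ge0 mulr_ge0 ?exprn_ge0 ?ltW.
Qed.

(** Grouped by the value [k] of [o], at most [k] elements share that value, being roots of X^k - 1;
    the sum is thus at most that of the inverse squares. *)
Lemma sum_inv_order_le2 (o : C -> nat) l : uniq l ->
  (forall z, z \in l -> (0 < o z)%N /\ z ^+ o z = 1) ->
  \sum_(z <- l) ((o z)%:R ^- 3 : R) <= 2.
Proof.
move=> ul ol; pose N := \max_(z <- l) o z.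
have oN z : z \in l -> (o z <= N)%N by move=> zl; exact: leq_bigmax_seq.
apply: le_trans (sum_inv_sqr_le2 N).
have -> : \sum_(z <- l) ((o z)%:R ^- 3 : R) =
    \sum_(z <- l) \sum_(k < N) (if o z == k.+1 then k.+1%:R ^- 3 else 0).
  rewrite big_seq [RHS]big_seq; apply: eq_bigr => z zl.
  have [oz0 _] := ol z zl.
  have kN : ((o z).-1 < N)%N by rewrite prednK// oN.
  rewrite (bigD1 (Ordinal kN))//= prednK// eqxx big1 ?addr0// => k kz.
  case: eqP => // ozk; case/eqP: kz; apply/val_inj.
  by rewrite /= ozk.
rewrite exchange_big/=; apply: ler_sum => k _.
rewrite -big_mkcond/= -big_filter big_const_seq count_predT iter_addr addr0.
have k0 : 0 < k.+1%:R :> R by rewrite ltr0n.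
rewrite -[leLHS]mulr_natl ler_pdivrMr ?exprn_gt0//.
apply: (@le_trans _ _ k.+1%:R); last first.
  by rewrite le_eqVlt; apply/orP; left; apply/eqP; field; rewrite gt_eqF.
rewrite ler_nat; apply: max_unity_roots => //; last exact: filter_uniq.
apply/allP => z; rewrite mem_filter => /andP[/eqP oz zl].
by apply/unity_rootP; rewrite -oz; exact: (ol z zl).2.
Qed.

Lemma dual_order z : dualZS s z -> exists n, is_order z n.
Proof.
move=> [m zm]; have [n pz _] := prim_order_exists (sc_pos s m) zm.
exists n; split; first exact: prim_order_gt0 pz.
split; first exact: prim_expr_order.
move=> k /andP[k0 kn] /eqP; rewrite -(prim_order_dvd pz) => /(dvdn_leq k0).
by rewrite leqNgt kn.
Qed.

Hypothesis lamP : length_fn s lam.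
Hypothesis lam_grows : grows_fast s lam.

(** Fast growth raised to the power [M] bounds [lam z ^- M] by [c ^- M] times the inverse cube of
    the order, once [al * M >= 3]. *)
Lemma lam_summable : exists M (K : R), 0 <= K /\ forall l, uniq l ->
  (forall z, z \in l -> dualZS s z) -> \sum_(z <- l) lam z ^- M <= K.
Proof.
case: lam_grows => al [c [al0 [c0 lamo]]].
pose M := (Num.truncn (3 / al)).+1.
have aM : 3 <= al * M%:R by rewrite mulrC -ler_pdivrMr// ltW// truncnS_gt.
(* Choice needs a total function; outside the dual the value is a dummy 0. *)
have ordz z : exists n, dualZS s z -> is_order z n.
  have [/dual_order[n zn]|nz] := pselect (dualZS s z); first by exists n.
  by exists 0%N.
have [n_ oP] := choice ordz.
exists M, (c ^- M * 2); split; first by rewrite mulr_ge0 ?invr_ge0 ?exprn_ge0 ?ltW.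
move=> l ul dl.
apply: (@le_trans _ _ (c ^- M * \sum_(z <- l) (n_ z)%:R ^- 3)); last first.
  rewrite ler_wpM2l ?invr_ge0 ?exprn_ge0 ?(ltW c0)//.
  by apply: sum_inv_order_le2 => // z /dl/oP[oz [zo _]].
rewrite mulr_sumr big_seq [leRHS]big_seq; apply: ler_sum => z /dl dz.
have [oz [zo zk]] := oP z dz.
have o1 : 1 <= (n_ z)%:R :> R by rewrite ler1n.
have o0 : 0 < (n_ z)%:R :> R by rewrite ltr0n.
have lz := lam_gt0 lamP dz.
rewrite -invfM lef_pV2 ?posrE ?mulr_gt0 ?exprn_gt0//.
apply: (@le_trans _ _ ((c * (n_ z)%:R `^ al) ^+ M)); last first.
  rewrite lerXn2r ?nnegrE ?mulr_ge0 ?powR_ge0 ?(ltW c0) ?(ltW lz)//.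
  exact: lamo (oP z dz).
rewrite exprMn ler_wpM2l ?exprn_ge0 ?(ltW c0)//.
rewrite -!powR_mulrn ?powR_ge0 ?(ltW o0)// -powRrM.
exact: ler_powR.
Qed.

(** The decay bound at exponent [N + M] leaves a factor [lam z ^- M] to sum. *)
Lemma CRD_decay g : contZS g ->
  (forall N, exists B, forall z, dualZS s z -> normc (fhat g z) * lam z ^+ N <= B) ->
  CRD lam g.
Proof.
move=> cg gN; apply/(CRDP lamP); split=> // N.
have [M [K [K0 KP]]] := lam_summable; have [B BP] := gN (N + M)%N.
have B0 : 0 <= B.
  apply: le_trans (BP 1 (dualZS1 _ s)).
  by rewrite mulr_ge0 ?normc_ge0 ?(lamX_ge0 lamP)//; exact: dualZS1.
exists (B * K) => l ul dl; apply: le_trans (ler_wpM2l B0 (KP l ul dl)).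
rewrite mulr_sumr big_seq [leRHS]big_seq; apply: ler_sum => z /dl dz.
have lz := lam_gt0 lamP dz.
by rewrite ler_pdivlMr ?exprn_gt0// -mulrA -exprD BP.
Qed.

End Summability.

(** * Smooth functional calculus through Lipschitz bounds *)

Section FunctionalCalculus.
Variables (R : realType) (s : scale) (lam : R[i] -> R).
Local Notation C := R[i].
Local Notation normc := (@ComplexField.Normc.normc R).
Implicit Types (f g : ZS s -> C) (x y : ZS s) (e B : R) (z w : C) (l : seq C).
#[local] Arguments ComplexField.Normc.normc : simpl never.

(** The derivative is itself derivable, hence continuous at [a] and bounded nearby; the mean value
    theorem concludes. *)
Lemma smooth_locally_lipschitz (U : set R) (h : R -> R) (a : R) :
  open U -> U a -> smooth_on U h ->
  exists2 r, 0 < r & exists2 L, 0 <= L & forall b b', `|b - a| < r -> `|b' - a| < r ->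
    `|h b - h b'| <= L * `|b - b'|.
Proof.
move=> oU Ua hU.
have dh t : U t -> derivable h t 1 by exact: hU 0%N t.
have ch' : {for a, continuous (h^`())%classic}.
  by apply: differentiable_continuous; apply/derivable1_diffP; exact: hU 1%N a Ua.
have /nbhs_ballP[r /= r0 rP] : nbhs a [set t | U t /\ `|h^`()%classic t| <= `|h^`()%classic a| + 1].
  have h1 : \forall t \near a, U t by exact: open_nbhs_nbhs.
  have h2 : \forall t \near a, `|h^`()%classic a - h^`()%classic t| < 1.
    by move/cvgrPdist_lt : ch' => /(_ 1 ltr01).
  near=> t; split; first by near: t.
  have : `|h^`()%classic a - h^`()%classic t| < 1 by near: t.
  have := ler_normB (h^`()%classic a) (h^`()%classic a - h^`()%classic t); rewrite subKr; lra.
exists r => //; exists (`|h^`()%classic a| + 1); first by rewrite addr_ge0.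
move=> b b'; wlog bb' : b b' / b <= b'.
  move=> H br b'r; have [bb'|/ltW bb'] := leP b b'; first exact: H.
  by rewrite distrC [`|b - b'|]distrC; exact: H.
move=> br b'r.
have inU t : t \in `[b, b'] -> ball a r t.
  rewrite in_itv/= => /andP[bt tb']; rewrite /ball/= distrC ltr_norml.
  by move: br b'r; rewrite !ltr_norml => /andP[h1 h2] /andP[h3 h4]; apply/andP; split; lra.
have [||c cb E] := @MVT_segment R h (h^`()%classic) b b' bb'.
- move=> t tb; rewrite derive1E; apply: DeriveDef => //.
  by apply: dh; apply: (rP t _).1; apply: inU; exact: subset_itv_oo_cc.
- apply: derivable_within_continuous => t tb; apply: dh.
  by apply: (rP t _).1; exact: inU.
rewrite distrC E normrM [`|b - b'|]distrC ler_wpM2r//.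
by apply: (rP c _).2; exact: inU.
Unshelve. all: by end_near.
Qed.


Section Composition.
Variables (f : ZS s -> C) (U : set R) (F : R -> C).
Hypotheses (cf : contZS f) (oU : open U) (fU : forall x, U (complex.Re (f x))).
Hypotheses (FRe : smooth_on U (fun t => complex.Re (F t))).
Hypotheses (FIm : smooth_on U (fun t => complex.Im (F t))).
Local Notation rf x := (complex.Re (f x)).
Local Notation G := (fun x => F (complex.Re (f x))).

(** The single integer [M] is both the Lipschitz constant and, as [M.+1], the inverse radius. This
    makes the property monotone in [M], as [ZS_uniform_bound] requires. *)
Lemma uniform_local_lipschitz : exists M : nat, forall x b,
  `|b - rf x| < M.+1%:R^-1 -> normc (F b - F (rf x)) <= M%:R * `|b - rf x|.
Proof.
apply: (@ZS_uniform_bound s (fun M x => forall b,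
    `|b - rf x| < M.+1%:R^-1 -> normc (F b - F (rf x)) <= M%:R * `|b - rf x|)).
  move=> m n x mn h b bx; apply: le_trans (h b _) _.
    apply: lt_le_trans bx _.
    by rewrite lef_pV2 ?posrE ?ltr0n// ler_nat.
  by rewrite ler_wpM2r// ler_nat.
move=> x.
have [r1 r10 [L1 L10 h1]] := smooth_locally_lipschitz oU (fU x) FRe.
have [r2 r20 [L2 L20 h2]] := smooth_locally_lipschitz oU (fU x) FIm.
pose r := Num.min r1 r2; have r0 : 0 < r by rewrite lt_min r10 r20.
have r02 : 0 < r / 2 by rewrite divr_gt0.
have [m mP] := cf x r02.
(* [M] dominates the level [m], the Lipschitz constants and the inverse of [r / 2]; half of [r] is
   spent from [x] to [y], the other half from [y] to [b]. *)
pose M := maxn m (maxn (Num.truncn (L1 + L2)).+1 (Num.truncn (r / 2)^-1).+1).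
have ML : L1 + L2 <= M%:R.
  apply: le_trans (ltW (truncnS_gt _)) _.
  by rewrite ler_nat /M !leq_max leqnn orbT.
have Mr : M.+1%:R^-1 <= r / 2.
  rewrite -[leRHS]invrK lef_pV2 ?posrE ?ltr0n ?invr_gt0//.
  apply: le_trans (ltW (truncnS_gt _)) _.
  by rewrite ler_nat leqW// /M !leq_max leqnn !orbT.
exists M => y /(ZS_eq_le (leq_maxl _ _))/mP fyx b bfy.
have yx : `|rf y - rf x| < r / 2.
  by rewrite -raddfB; exact: le_lt_trans (normc_geRe _) fyx.
have bx : `|b - rf x| < r.
  rewrite -(subrKA (rf y)) [r]splitr (le_lt_trans (ler_normD _ _))// ltrD//.
  exact: lt_le_trans bfy Mr.
have yxr : `|rf y - rf x| < r by lra.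
move: bx yxr; rewrite /r !lt_min => /andP[bx1 bx2] /andP[yx1 yx2].
apply: le_trans (normc_leReIm _) _.
rewrite !raddfB/=; apply: le_trans (lerD (h1 _ _ bx1 yx1) (h2 _ _ bx2 yx2)) _.
by rewrite -mulrDl ler_wpM2r.
Qed.

Lemma contZS_comp : contZS G.
Proof.
have [M MP] := uniform_local_lipschitz => x e e0.
have M0 : 0 < M.+1%:R :> R by rewrite ltr0n.
have d0 : 0 < Num.min M.+1%:R^-1 (e / M.+1%:R).
  by rewrite lt_min invr_gt0 M0 divr_gt0.
have [m mP] := cf x d0; exists m => y /mP.
rewrite lt_min => /andP[h1 h2].
have yx : `|rf y - rf x| <= normc (f y - f x) by rewrite -raddfB normc_geRe.
apply: le_lt_trans (MP x _ (le_lt_trans yx h1)) _.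
apply: (@le_lt_trans _ _ (M.+1%:R * `|rf y - rf x|)).
  by rewrite ler_wpM2r// ler_nat.
by rewrite mulrC -ltr_pdivlMr//; exact: le_lt_trans yx h2.
Qed.

(** Values of [f] closer than the uniform radius use the local bound; for the others the crude bound
    [B + B] is at most [(B + B) * M.+1] times their distance. *)
Lemma comp_lipschitz : exists2 L : R, 0 <= L & forall x y,
  normc (G y - G x) <= L * `|rf y - rf x|.
Proof.
have [M MP] := uniform_local_lipschitz.
have [B B0 GB] := contZS_bounded contZS_comp.
have M0 : 0 < M.+1%:R :> R by rewrite ltr0n.
have BM0 : 0 <= (B + B) * M.+1%:R by rewrite mulr_ge0 ?addr_ge0 ?(ltW M0).
exists (M%:R + (B + B) * M.+1%:R) => [|x y]; first by rewrite addr_ge0.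
have [yx|yx] := ltP `|rf y - rf x| M.+1%:R^-1.
  by apply: le_trans (MP _ _ yx) _; rewrite ler_wpM2r// lerDl.
apply: (@le_trans _ _ ((B + B) * M.+1%:R * `|rf y - rf x|)); last first.
  by rewrite ler_wpM2r// lerDr.
apply: (@le_trans _ _ (B + B)).
  by rewrite (le_trans (normc_triangle _ _))// normc_opp lerD.
rewrite -mulrA ler_peMr ?addr_ge0//.
by rewrite -ler_pdivrMl// mulr1.
Qed.

End Composition.

Hypothesis lamP : length_fn s lam.
Hypothesis lam_grows : grows_fast s lam.

(** With [n] separating [z] from all shorter characters, translates of [f] by multiples of [n] stay
    within [2 * B / lam z ^+ N], those of [g] within [L] times that, and this bounds the
    [z]-coefficient of [g]. *)
Lemma CRD_lipschitz f g (L : R) : CRD lam f -> contZS g -> 0 <= L ->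
  (forall x y, normc (g y - g x) <= L * normc (f y - f x)) -> CRD lam g.
Proof.
move=> /(CRDP lamP)[cf fN] cg L0 gL; apply: (CRD_decay lamP lam_grows) => // N.
have [B fB] := fN N; have B0 := norm_bounded_ge0 fB.
have [D D0 gD] := contZS_bounded cg.
(* [D] handles [z = 1], which no exponent separates; the second term handles all other
   characters. *)
exists (D + L * (2 * B)) => z dz.
have [->|z1] := eqVneq z 1.
  rewrite (lam1 lamP) expr1n mulr1; apply: le_trans (fhat_le cg (dualZS1 _ s) gD) _.
  by rewrite lerDl !mulr_ge0.
have [n [zn nP]] := separating_exponent lamP dz z1.
have lz := lam_gt0 lamP dz; have lzN : 0 < lam z ^+ N by rewrite exprn_gt0.
apply: (@le_trans _ _ (L * (2 * B))); last by rewrite lerDr.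
rewrite -ler_pdivlMr// -mulrA; apply: fhat_le_translates zn _ => // k x.
apply: le_trans (gL _ _) _; rewrite ler_wpM2l//.
exact: (translate_close lamP k x cf fB lz nP).
Qed.

End FunctionalCalculus.

(** * Algebra operations, density and completeness *)

Section FrechetAlgebra.
Variables (R : realType) (s : scale) (lam : R[i] -> R).
Local Notation C := R[i].
Local Notation normc := (@ComplexField.Normc.normc R).
Local Notation CRD := (@CRD R s lam).
Implicit Types (f g : ZS s -> C) (x y : ZS s) (e B : R) (z w : C).
#[local] Arguments ComplexField.Normc.normc : simpl never.
Hypothesis lamP : length_fn s lam.

Lemma CRD_cst (c : C) : CRD (fun=> c).
Proof.
have d1 := @dualZS1 R s.
apply/(CRDP lamP); split=> [|N]; first exact: contZS_cst.
have := norm_boundedZ c (contZS_chi d1) (norm_bounded_chi lamP N d1).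
under [X in norm_bounded _ _ X _]eq_fun do rewrite chiZS1 mulr1.
by exists (normc c * lam 1 ^+ N).
Qed.

Lemma CRD_D f g : CRD f -> CRD g -> CRD (fun x => f x + g x).
Proof.
move=> /(CRDP lamP)[cf fB] /(CRDP lamP)[cg gB]; apply/(CRDP lamP).
split=> [|N]; first exact: contZSD.
have [B BP] := fB N; have [B' BP'] := gB N.
by exists (B + B'); exact: norm_boundedD.
Qed.

Lemma CRD_M f g : CRD f -> CRD g -> CRD (fun x => f x * g x).
Proof.
move=> /(CRDP lamP)[cf fB] /(CRDP lamP)[cg gB]; apply/(CRDP lamP).
split=> [|N]; first exact: contZSM.
have [B BP] := fB N; have [B' BP'] := gB N.
by exists (B * B'); exact: norm_boundedM.
Qed.

Lemma CRD_Z (c : C) f : CRD f -> CRD (fun x => c * f x).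
Proof. exact/CRD_M/CRD_cst. Qed.

Lemma CRD_conj f : CRD f -> CRD (fun x => conjc (f x)).
Proof.
move=> /(CRDP lamP)[cf fB]; apply/(CRDP lamP).
split=> [|N]; first exact: contZS_conj.
by have [B BP] := fB N; exists B; exact: norm_bounded_conj.
Qed.

Lemma CRD_sum (I : Type) (r : seq I) (F : I -> ZS s -> C) :
  (forall i, CRD (F i)) -> CRD (fun x => \sum_(i <- r) F i x).
Proof.
move=> cF; elim: r => [|i r IH].
  by under eq_fun do rewrite big_nil; exact: CRD_cst.
by under eq_fun do rewrite big_cons; exact: CRD_D.
Qed.

Lemma CRD_chi w : dualZS s w -> CRD (@chiZS R s w).
Proof.
move=> dw; apply/(CRDP lamP); split=> [|N]; first exact: contZS_chi.
by exists (lam w ^+ N); exact: norm_bounded_chi.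
Qed.

Lemma CRD_dense f e : contZS f -> 0 < e ->
  exists g, CRD g /\ forall x, normc (f x - g x) < e.
Proof.
move=> cf e0; have e2 : 0 < e / 2 by rewrite divr_gt0.
have [m mP] := fourier_sum_cvg cf e2; have [w pw] := primitive_rootC R (sc_pos s m).
exists (fourier_sum w m f); split.
  by apply: CRD_sum => i; apply/CRD_Z/CRD_chi; exact: prim_root_dual pw.
move=> x; rewrite normcB; apply: le_lt_trans (mP m w (leqnn _) pw x) _; lra.
Qed.

(** Domination of the sup norm gives a uniform limit [h]. For fixed [n], the differences of [g n]
    with later terms are uniformly bounded in each norm, and Fatou's lemma passes the bound to
    [g n - h]. *)
Lemma CRD_complete (g : nat -> ZS s -> C) : (forall n, CRD (g n)) ->
  (forall N e, 0 < e -> exists n0, forall p q, (n0 <= p)%N -> (n0 <= q)%N ->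
     norm_bounded lam N (fun x => g p x - g q x) e) ->
  exists h, CRD h /\ forall N e, 0 < e -> exists n0, forall n, (n0 <= n)%N ->
     norm_bounded lam N (fun x => g n x - h x) e.
Proof.
move=> gC gcauchy.
have cg n : contZS (g n) by case: (gC n).
have cgg p q : contZS (fun x => g p x - g q x) by exact: contZSB.
have gsup e : 0 < e -> exists n0, forall p q, (n0 <= p)%N -> (n0 <= q)%N ->
    forall x, normc (g p x - g q x) <= e.
  move=> /(gcauchy 0%N)[n0 n0P]; exists n0 => p q pn qn x.
  exact: (normc_le_norm lamP x (cgg p q) (n0P p q pn qn)).
have /choice[h hP] : forall x, exists c, cvgC (fun n => g n x) c.
  move=> x; apply: cvgC_cauchy => e e0.
  have e2 : 0 < e / 2 by rewrite divr_gt0.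
  have [n0 n0P] := gsup _ e2; exists n0 => n nn.
  by apply: le_lt_trans (n0P n n0 nn (leqnn _) x) _; lra.
have hsup e : 0 < e -> exists n0, forall n, (n0 <= n)%N ->
    forall x, normc (g n x - h x) <= e.
  move=> /gsup[n0 n0P]; exists n0 => n nn x.
  have := cvgCD (cvgC_cst (g n x)) (cvgCZ (-1) (hP x)); rewrite mulN1r.
  move=> /cvgC_norm_le; apply; exists n0 => q qn; rewrite mulN1r.
  exact: n0P.
have ch : contZS h.
  apply: contZS_uniform_limit => e /hsup[n0 n0P]; exists (g n0); split=> // x.
  by rewrite normcB; exact: n0P.
have ghN N e : 0 < e -> exists n0, forall n, (n0 <= n)%N ->
    norm_bounded lam N (fun x => g n x - h x) e.
  move=> /(gcauchy N)[n0 n0P]; exists n0 => n nn.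
  apply: (norm_bounded_limit lamP); first exact: contZSB.
  move=> d /hsup[n1 n1P]; exists (fun x => g n x - g (maxn n0 n1) x); split => //.
    by apply: n0P => //; exact: leq_maxl.
  move=> x; have -> : g n x - h x - (g n x - g (maxn n0 n1) x) = g (maxn n0 n1) x - h x by ring.
  by apply: n1P; exact: leq_maxr.
exists h; split=> //; apply/(CRDP lamP); split=> // N.
have [n0 n0P] := ghN N 1 ltr01; have /(CRDP lamP)[_ /(_ N)[B BP]] := gC n0.
(* The limit lies within distance 1 of [g n0], whose norm is finite. *)
exists (B + 1); have -> : h = fun x => g n0 x - (g n0 x - h x).
  by apply: funext => x; rewrite subKr.
apply: (norm_boundedB lamP) => //; first exact: contZSB.
exact: n0P.
Qed.

Lemma normN_submult N f g : CRD f -> CRD g ->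
  (normN lam N (fun x => (f x * g x)%R) <= normN lam N f * normN lam N g)%E.
Proof.
move=> fC gC; rewrite -(fineK (normN_fin_num lamP N fC)) -(fineK (normN_fin_num lamP N gC)).
rewrite -EFinM; apply/normN_leP.
apply: norm_boundedM => //; try exact: norm_bounded_normN.
  by case: fC.
by case: gC.
Qed.

Lemma normc_le_normN N f x : CRD f -> ((normc (f x))%:E <= normN lam N f)%E.
Proof.
move=> fC; rewrite -(fineK (normN_fin_num lamP N fC)) lee_fin.
by apply: (normc_le_norm lamP) (norm_bounded_normN lamP N fC); case: fC.
Qed.

End FrechetAlgebra.

Theorem mainTheorem8 (R : realType) (s : scale) (lam : R[i] -> R) :
  length_fn s lam -> grows_fast s lam ->
  let C_RD := @CRD R s lam in
  let nrm := @normN R s lam in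
  let normc := @ComplexField.Normc.normc R in
  (   (* C_RD is a unital *-subalgebra of C(Z_S) *)
   (C_RD (fun _ => 1) /\
    (forall f g, C_RD f -> C_RD g -> C_RD (fun x => f x + g x)) /\
    (forall (a : R[i]) f, C_RD f -> C_RD (fun x => a * f x)) /\
    (forall f g, C_RD f -> C_RD g -> C_RD (fun x => f x * g x)) /\
    (forall f, C_RD f -> C_RD (fun x => conjc (f x)))) /\
   (* density in C(Z_S) for the sup norm *)
   (forall f : ZS s -> R[i], contZS f -> forall e : R, 0 < e ->
      exists g, C_RD g /\ forall x, normc (f x - g x) < e) /\
   (* each ||.||_N dominates the sup norm *)
   (forall f N, C_RD f -> forall x, ((normc (f x))%:E <= nrm N f)%E) /\
   (* completeness (Frechet) for the family of norms ||.||_N *)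
   (forall g : nat -> ZS s -> R[i], (forall n, C_RD (g n)) ->
      (forall N (e : R), 0 < e -> exists n0, forall p q, (n0 <= p)%N -> (n0 <= q)%N ->
          (nrm N (fun x => (g p x - g q x)%R) < e%:E)%E) ->
      exists h, C_RD h /\
        forall N (e : R), 0 < e -> exists n0, forall n, (n0 <= n)%N ->
          (nrm N (fun x => (g n x - h x)%R) < e%:E)%E) /\
   (* submultiplicativity *)
   (forall N f g, C_RD f -> C_RD g ->
      (nrm N (fun x => (f x * g x)%R) <= nrm N f * nrm N g)%E) /\
   (* stability under smooth functional calculus of self-adjoint elements *)
   (forall (f : ZS s -> R[i]) (U : set R) (F : R -> R[i]),
      C_RD f -> (forall x, complex.Im (f x) = 0) ->
      open U -> (forall x, U (complex.Re (f x))) ->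
      smooth_on U (fun t => complex.Re (F t)) ->
      smooth_on U (fun t => complex.Im (F t)) ->
      C_RD (fun x => F (complex.Re (f x))))).

Proof.
move=> lamP lam_grows /=; split; last split; last split; last split; last split.
- split; first exact: CRD_cst.
  split; first exact: CRD_D.
  split; first exact: CRD_Z.
  split; [exact: CRD_M|exact: CRD_conj].
- by move=> f cf e; exact: CRD_dense.
- by move=> f N fC x; exact: normc_le_normN.
- move=> g gC gcauchy; have [|h [hC hP]] := CRD_complete lamP gC.
    move=> N e /(gcauchy N)[n0 n0P]; exists n0 => p q pn qn.
    by apply/normN_leP/ltW; exact: n0P.
  (* Bounds on finite sums give only a weak inequality; [e / 2] makes it strict. *)
  exists h; split=> // N e e0; have e2 : 0 < e / 2 by rewrite divr_gt0.
  have [n0 n0P] := hP N _ e2; exists n0 => n /n0P/normN_leP h1.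
  by apply: le_lt_trans h1 _; rewrite lte_fin; lra.
- by move=> N f g; exact: normN_submult.
- move=> f U F fC imf oU fU FRe FIm; have cf : contZS f by case: fC.
  have [L L0 FL] := comp_lipschitz cf oU fU FRe FIm.
  apply: (CRD_lipschitz lamP lam_grows fC _ L0).
    exact: contZS_comp cf oU fU FRe FIm.
  move=> x y; apply: le_trans (FL x y) _; rewrite ler_wpM2l//.
  by rewrite -raddfB normc_geRe.
Qed.
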